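(* (Strong completeness of $F\!F\!D\!E$.) Let $\mathcal{L}$ be a first-order language and $\Gamma\cup\{A\}\subseteq Sent(\mathcal{L})$. If $\Gamma\vDash A$ (i.e., for every Kripke $F\!F\!D\!E$-model $\mathcal{K}$ for $\mathcal{L}$ and every stage $w$, if all sentences of $\Gamma$ hold at $w$ then $A$ holds at $w$), then $\Gamma\vdash_\mathcal{L}A$ in the natural deduction system $F\!F\!D\!E$.
   Context: Language: connectives $\neg,\land,\lor$, quantifiers $\forall,\exists$, variables, identity $\doteq$, unary definedness predicate $\mathbf{D}$. A first-order language is $\mathcal{L}=\langle\mathcal{C},\mathcal{P}\rangle$, $\mathcal{C}$ an infinite set of constants, $\mathcal{P}$ a (possibly empty) set of predicate letters of finite arities; $\mathcal{P}^{\doteq}=\mathcal{P}\cup\{\doteq\}$; atomic formulas are $Pt_1\dots t_m$, $t_1\doteq t_2$, $\mathbf{D}t$; $c_1\neq c_2$ abbreviates $\neg(c_1\doteq c_2)$; $A(c/x)$ is substitution of $c$ for free $x$. Proof system: deductions are natural-deduction trees of sentences of $\mathcal{L}$; $\Gamma\vdash_\mathcal{L}A$ means a deduction of $A$ with undischarged hypotheses in $\Gamma$. Rules: $\land$I ($A,B/A\land B$); $\land$E ($A\land B/A$, $A\land B/B$); $\lor$I ($A/A\lor B$, $B/A\lor B$); $\lor$E (from $A\lor B$ and derivations of $C$ from $A$ and from $B$, infer $C$, discharging); $\neg\land$I ($\neg A/\neg(A\land B)$, $\neg B/\neg(A\land B)$); $\neg\land$E (from $\neg(A\land B)$ and derivations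 of $C$ from $\neg A$ and from $\neg B$, infer $C$); $\neg\lor$I ($\neg A,\neg B/\neg(A\lor B)$); $\neg\lor$E ($\neg(A\lor B)/\neg A$, $/\neg B$); DN ($A/\neg\neg A$, $\neg\neg A/A$); $\mathbf{D}$I (for $m$-ary $P\in\mathcal{P}^{\doteq}$, $1\le i\le m$: $Pc_1..c_m/\mathbf{D}c_i$ and $\neg Pc_1..c_m/\mathbf{D}c_i$); PEX$_\mathbf{D}$ ($\mathbf{D}c,\neg\mathbf{D}c/B$); PEM$_\mathbf{D}$ (infer $\mathbf{D}c\lor\neg\mathbf{D}c$ outright); $\forall$I$_\mathbf{D}$ (from a derivation of $A(c/x)$ from $\mathbf{D}c$ infer $\forall xA$, discharging $\mathbf{D}c$); $\forall$E$_\mathbf{D}$ ($\forall xA,\mathbf{D}c/A(c/x)$); $\exists$I$_\mathbf{D}$ ($A(c/x),\mathbf{D}c/\exists xA$); $\exists$E$_\mathbf{D}$ (from $\exists xA$ and a derivation of $B$ from $A(c/x),\mathbf{D}c$ infer $B$, discharging); $\neg\forall$I$_\mathbf{D}$ ($\neg A(c/x),\mathbf{D}c/\neg\forall xA$); $\neg\forall$E$_\mathbf{D}$ (from $\neg\forall xA$ and a derivation of $B$ from $\neg A(c/x),\mathbf{D}c$ infer $B$, discharging); $\neg\exists$I$_\mathbf{D}$ (from a derivation of $\neg A(c/x)$ from $\mathbf{D}c$ infer $\neg\exists xA$, discharging); $\neg\exists$E$_\mathbf{D}$ ($\neg\exists xA,\mathbf{D}c/\neg A(c/x)$); $\doteq$I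 ($\mathbf{D}c/c\doteq c$); $\doteq$E ($A(c_1/x),c_1\doteq c_2/A(c_2/x)$, $A$ atomic or negated atomic); $\neq$I ($A(c_1/x),\neg A(c_2/x)/c_1\neq c_2$, $A$ atomic with $x$ free). Eigenvariable restrictions: in $\forall$I$_\mathbf{D}$, $\neg\exists$I$_\mathbf{D}$, $c$ does not occur in $A$ nor in any undischarged hypothesis other than $\mathbf{D}c$; in $\exists$E$_\mathbf{D}$, $\neg\forall$E$_\mathbf{D}$, $c$ does not occur in $A$, $B$, nor in hypotheses of the minor derivation other than the discharged ones. Semantics: a Kripke $F\!F\!D\!E$-model for $\mathcal{L}$ is $\langle W,\le,d,I,i_+,i_-\rangle$: $W\neq\emptyset$; $\le$ a preorder; $d(w)$ a possibly empty set, $d(w)\subseteq d(w')$ for $w\le w'$; $I$ partial on $(\mathcal{C}\cup\mathcal{P})\times W$ with $I(c,w)\in d(w)$ when defined and then $I(c,w')=I(c,w)$ for $w'\ge w$; $I(P,w)=\langle P^w_+,P^w_-\rangle$, $P^w_\pm\subseteq d(w)^m$, monotone in $w$; $i_\pm(w)$ binary relations on $d(w)$ with (a) $i_+(w)$ an equivalence relation and a congruence for each $P^w_+$ and $P^w_-$ ($P\in\mathcal{P}$); (b) with $\doteq^w_\pm=i_\pm(w)$: if for some $P\in\mathcal{P}^{\doteq}$ a tuple containing $a$ lies in $P^w_+$ and the same tuple with $a'$ in place of $a$ (same positions) lies in $P^w_-$, then $\langle a,a'\rangle,\langle a',a\rangle\in i_-(w)$; (c) $i_\pm$ monotone in $w$.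 Diagram language $\mathcal{L}_\mathcal{K}$ adds constants $\bar a$ for $a\in\bigcup_w d(w)$; $\hat I(\bar a,w)=a$ if $a\in d(w)$, undefined otherwise, else $\hat I=I$. Induced valuation $v$ on $Sent(\mathcal{L}_\mathcal{K})\times W$: $v(\mathbf{D}c,w)=1$ iff $\hat I(c,w)$ defined; $v(\neg\mathbf{D}c,w)=1$ iff undefined; $v(c_1\doteq c_2,w)=1$ (resp. $v(c_1\neq c_2,w)=1$) iff $\hat I(c_1,w),\hat I(c_2,w)$ defined and their pair is in $i_+(w)$ (resp. $i_-(w)$); for $P\in\mathcal{P}$, $v(Pc_1..c_m,w)=1$ (resp. $v(\neg Pc_1..c_m,w)=1$) iff all $\hat I(c_i,w)$ defined and the tuple is in $P^w_+$ (resp. $P^w_-$); $\land,\lor$ classical; $v(\neg(A\land B))=1$ iff $v(\neg A)=1$ or $v(\neg B)=1$; $v(\neg(A\lor B))=1$ iff both $v(\neg A)=v(\neg B)=1$; $v(\neg\neg A)=v(A)$; $v(\forall xA,w)=1$ iff $v(A(\bar a/x),w')=1$ for all $w'\ge w$, $a\in d(w')$; $v(\exists xA,w)=1$ iff $v(A(\bar a/x),w)=1$ for some $a\in d(w)$; $v(\neg\forall xA,w)=1$ iff $v(\neg A(\bar a/x),w)=1$ for some $a\in d(w)$; $v(\neg\exists xA,w)=1$ iff $v(\neg A(\bar a/x),w')=1$ for all $w'\ge w$, $a\in d(w')$. $A$ holds at $w$ ($\mathcal{K},w\vDash A$) iff $v(A,w)=1$. *)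

(* Defs.v *)
From mathcomp Require Import all_boot.
From mathcomp Require Import boolp classical_sets functions cardinality.

Set Implicit Arguments.
Unset Strict Implicit.
Unset Printing Implicit Defensive.

Local Open Scope classical_set_scope.

Record language := Language {
  const : Type;
  letter : Type;
  arity : letter -> nat;
  const_infinite : infinite_set [set: const] }.

(* The predicate letters together with the identity symbol, which is [None]. *)
Definition predE (L : language) : Type := option (letter L).

Definition arityE (L : language) (p : predE L) : nat :=
  if p is Some q then arity q else 2.

Inductive term (L : language) : Type :=
  | Var of nat
  | Cst of const L.

Arguments Var {L} _.

Inductive form (L : language) : Type :=
  | fPred (p : predE L) (ts : (arityE p).-tuple (term L))
  | fDef of term L
  | fNeg of form L
  | fAnd of form L & form L
  | fOr of form L & form L
  | fAll of nat & form L
  | fEx of nat & form L.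

Definition fEq (L : language) (s t : term L) : form L :=
  @fPred L None [tuple s; t].

Definition atomic (L : language) (A : form L) : bool :=
  match A with fPred _ _ | fDef _ => true | _ => false end.

Definition literal (L : language) (A : form L) : bool :=
  match A with fNeg B => atomic B | _ => atomic A end.

Definition free_term (L : language) (x : nat) (t : term L) : bool :=
  if t is Var y then y == x else false.

Fixpoint free (L : language) (x : nat) (A : form L) : bool :=
  match A with
  | fPred _ ts => has (free_term x) ts
  | fDef t => free_term x t
  | fNeg B => free x B
  | fAnd B C | fOr B C => free x B || free x C
  | fAll y B | fEx y B => (y != x) && free x B
  end.

Definition sentence (L : language) (A : form L) : Prop :=
  forall x, ~~ free x A.

Fixpoint occurs (L : language) (c : const L) (A : form L) : Prop :=
  match A with
  | fPred _ ts => exists i, tnth ts i = Cst c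
  | fDef t => t = Cst c
  | fNeg B => occurs c B
  | fAnd B C | fOr B C => occurs c B \/ occurs c C
  | fAll _ B | fEx _ B => occurs c B
  end.

Definition subst_term (L : language) (x : nat) (c : const L) (t : term L) :
    term L :=
  if t is Var y then (if y == x then Cst c else t) else t.

(* [subst x c A] is A(c/x); no capture can arise since [c] is a constant. *)
Fixpoint subst (L : language) (x : nat) (c : const L) (A : form L) : form L :=
  match A with
  | fPred p ts => @fPred L p (map_tuple (subst_term x c) ts)
  | fDef t => fDef (subst_term x c t)
  | fNeg B => fNeg (subst x c B)
  | fAnd B C => fAnd (subst x c B) (subst x c C)
  | fOr B C => fOr (subst x c B) (subst x c C)
  | fAll y B => if y == x then fAll y B else fAll y (subst x c B)
  | fEx y B => if y == x then fEx y B else fEx y (subst x c B)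
  end.

(* [ded H A]: there is a deduction tree of [A] whose set of undischarged
   hypotheses is [H] (hence finite).  Discharging [B] from a subderivation
   with hypotheses [H] leaves [H `\ B], and [B] need not be in [H].  The
   [sentence] premises on hypotheses and on the formulas that a rule
   introduces freely force every node of a tree to be a sentence; in
   particular the terms in [ded_DI_pos] and [ded_DI_neg] are constants. *)
Inductive ded (L : language) : set (form L) -> form L -> Prop :=
  | ded_hyp A : sentence A -> ded [set A] A
  | ded_andI H1 H2 A B :
      ded H1 A -> ded H2 B -> ded (H1 `|` H2) (fAnd A B)
  | ded_andEl H A B : ded H (fAnd A B) -> ded H A
  | ded_andEr H A B : ded H (fAnd A B) -> ded H B
  | ded_orIl H A B : sentence B -> ded H A -> ded H (fOr A B)
  | ded_orIr H A B : sentence A -> ded H B -> ded H (fOr A B)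
  | ded_orE H H1 H2 A B C :
      ded H (fOr A B) -> ded H1 C -> ded H2 C ->
      ded (H `|` (H1 `\ A) `|` (H2 `\ B)) C
  | ded_nandIl H A B : sentence B -> ded H (fNeg A) -> ded H (fNeg (fAnd A B))
  | ded_nandIr H A B : sentence A -> ded H (fNeg B) -> ded H (fNeg (fAnd A B))
  | ded_nandE H H1 H2 A B C :
      ded H (fNeg (fAnd A B)) -> ded H1 C -> ded H2 C ->
      ded (H `|` (H1 `\ fNeg A) `|` (H2 `\ fNeg B)) C
  | ded_norI H1 H2 A B :
      ded H1 (fNeg A) -> ded H2 (fNeg B) ->
      ded (H1 `|` H2) (fNeg (fOr A B))
  | ded_norEl H A B : ded H (fNeg (fOr A B)) -> ded H (fNeg A)
  | ded_norEr H A B : ded H (fNeg (fOr A B)) -> ded H (fNeg B)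
  | ded_DNI H A : ded H A -> ded H (fNeg (fNeg A))
  | ded_DNE H A : ded H (fNeg (fNeg A)) -> ded H A
  | ded_DI_pos H (p : predE L) (ts : (arityE p).-tuple (term L)) i :
      ded H (fPred ts) -> ded H (fDef (tnth ts i))
  | ded_DI_neg H (p : predE L) (ts : (arityE p).-tuple (term L)) i :
      ded H (fNeg (fPred ts)) -> ded H (fDef (tnth ts i))
  | ded_PEX H1 H2 c B :
      sentence B -> ded H1 (fDef (Cst c)) -> ded H2 (fNeg (fDef (Cst c))) ->
      ded (H1 `|` H2) B
  | ded_PEM c : ded set0 (fOr (fDef (Cst c)) (fNeg (fDef (Cst c))))
  | ded_allI H x c A :
      ded H (subst x c A) ->
      ~ occurs c A -> (forall B, (H `\ fDef (Cst c)) B -> ~ occurs c B) ->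
      ded (H `\ fDef (Cst c)) (fAll x A)
  | ded_allE H1 H2 x c A :
      ded H1 (fAll x A) -> ded H2 (fDef (Cst c)) ->
      ded (H1 `|` H2) (subst x c A)
  | ded_exI H1 H2 x c A :
      ded H1 (subst x c A) -> ded H2 (fDef (Cst c)) ->
      ded (H1 `|` H2) (fEx x A)
  | ded_exE H1 H2 x c A B :
      ded H1 (fEx x A) -> ded H2 B ->
      ~ occurs c A -> ~ occurs c B ->
      (forall C, (H2 `\ subst x c A `\ fDef (Cst c)) C -> ~ occurs c C) ->
      ded (H1 `|` (H2 `\ subst x c A `\ fDef (Cst c))) B
  | ded_nallI H1 H2 x c A :
      ded H1 (fNeg (subst x c A)) -> ded H2 (fDef (Cst c)) ->
      ded (H1 `|` H2) (fNeg (fAll x A))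
  | ded_nallE H1 H2 x c A B :
      ded H1 (fNeg (fAll x A)) -> ded H2 B ->
      ~ occurs c A -> ~ occurs c B ->
      (forall C, (H2 `\ fNeg (subst x c A) `\ fDef (Cst c)) C ->
                 ~ occurs c C) ->
      ded (H1 `|` (H2 `\ fNeg (subst x c A) `\ fDef (Cst c))) B
  | ded_nexI H x c A :
      ded H (fNeg (subst x c A)) ->
      ~ occurs c A -> (forall B, (H `\ fDef (Cst c)) B -> ~ occurs c B) ->
      ded (H `\ fDef (Cst c)) (fNeg (fEx x A))
  | ded_nexE H1 H2 x c A :
      ded H1 (fNeg (fEx x A)) -> ded H2 (fDef (Cst c)) ->
      ded (H1 `|` H2) (fNeg (subst x c A))
  | ded_eqI H c : ded H (fDef (Cst c)) -> ded H (fEq (Cst c) (Cst c))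
  | ded_eqE H1 H2 x c1 c2 A :
      literal A ->
      ded H1 (subst x c1 A) -> ded H2 (fEq (Cst c1) (Cst c2)) ->
      ded (H1 `|` H2) (subst x c2 A)
  | ded_neqI H1 H2 x c1 c2 A :
      atomic A -> free x A ->
      ded H1 (subst x c1 A) -> ded H2 (fNeg (subst x c2 A)) ->
      ded (H1 `|` H2) (fNeg (fEq (Cst c1) (Cst c2))).

Definition derivable (L : language) (G : set (form L)) (A : form L) : Prop :=
  exists2 H, H `<=` G & ded H A.

Section Extension.
Context {L : language} {W U : Type}.
Variables (i : W -> U -> U -> Prop)
          (P : W -> forall p : letter L, (arity p).-tuple U -> Prop).

Definition extension (w : W) (p : predE L) : (arityE p).-tuple U -> Prop :=
  match p with
  | Some q => fun us => P w us
  | None => fun us => i w (tnth us ord0) (tnth us ord_max)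
  end.

End Extension.

(* [ind] is the union of all the domains [dom w].  The premises of [ineg_diff]
   on tuples say that [vs] is [us] with one or more occurrences of [a] replaced
   by [b], which matches the templates A(c/x) of [ded_neqI], where [x] need not
   stand at every position of the replaced constant. *)
Record model (L : language) := Model {
  world : Type;
  wle : world -> world -> Prop;
  ind : Type;
  dom : world -> set ind;
  cval : world -> const L -> option ind;
  ppos : world -> forall p : letter L, (arity p).-tuple ind -> Prop;
  pneg : world -> forall p : letter L, (arity p).-tuple ind -> Prop;
  ipos : world -> ind -> ind -> Prop;
  ineg : world -> ind -> ind -> Prop;
  world_inhabited : inhabited world;
  wle_refl : forall w, wle w w;
  wle_trans : forall w1 w2 w3, wle w1 w2 -> wle w2 w3 -> wle w1 w3;
  ind_cover : forall a, exists w, dom w a;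
  dom_mono : forall w w', wle w w' -> dom w `<=` dom w';
  cval_dom : forall w c a, cval w c = Some a -> dom w a;
  cval_mono : forall w w' c a,
    wle w w' -> cval w c = Some a -> cval w' c = Some a;
  ppos_dom : forall w p (us : (arity p).-tuple ind),
    ppos w us -> forall k, dom w (tnth us k);
  pneg_dom : forall w p (us : (arity p).-tuple ind),
    pneg w us -> forall k, dom w (tnth us k);
  ppos_mono : forall w w' p (us : (arity p).-tuple ind),
    wle w w' -> ppos w us -> ppos w' us;
  pneg_mono : forall w w' p (us : (arity p).-tuple ind),
    wle w w' -> pneg w us -> pneg w' us;
  ipos_dom : forall w a b, ipos w a b -> dom w a /\ dom w b;
  ineg_dom : forall w a b, ineg w a b -> dom w a /\ dom w b;
  ipos_refl : forall w a, dom w a -> ipos w a a;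
  ipos_sym : forall w a b, ipos w a b -> ipos w b a;
  ipos_trans : forall w a b c, ipos w a b -> ipos w b c -> ipos w a c;
  ppos_congr : forall w p (us vs : (arity p).-tuple ind),
    (forall k, ipos w (tnth us k) (tnth vs k)) -> ppos w us -> ppos w vs;
  pneg_congr : forall w p (us vs : (arity p).-tuple ind),
    (forall k, ipos w (tnth us k) (tnth vs k)) -> pneg w us -> pneg w vs;
  ineg_diff : forall w (p : predE L) (us vs : (arityE p).-tuple ind) a b,
    (exists k, tnth us k = a /\ tnth vs k = b) ->
    (forall k, tnth us k = tnth vs k \/ (tnth us k = a /\ tnth vs k = b)) ->
    extension ipos ppos w us -> extension ineg pneg w vs ->
    ineg w a b /\ ineg w b a;
  ipos_mono : forall w w' a b, wle w w' -> ipos w a b -> ipos w' a b;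
  ineg_mono : forall w w' a b, wle w w' -> ineg w a b -> ineg w' a b }.

Lemma infinite_suml (T U : Type) :
  infinite_set [set: T] -> infinite_set [set: T + U].
Proof.
move=> infT finTU; have [t0 _] := infinite_setN0 infT.
apply: infT.
have /sub_finite_set : [set: T] `<=`
    (fun s : T + U => if s is inl t then t else t0) @` [set: T + U].
  by move=> t _; exists (inl t).
by apply; exact: finite_image.
Qed.

Definition diagram (L : language) (K : model L) : language :=
  @Language (const L + ind K) (letter L) (@arity L)
    (infinite_suml (@const_infinite L)).

Definition bar (L : language) (K : model L) (a : ind K) :
  const (diagram K) := inr a.

Definition diagram_term (L : language) (K : model L) (t : term L) :
    term (diagram K) :=
  match t with Var x => Var x | Cst c => @Cst (diagram K) (inl c) end.

Fixpoint diagram_form (L : language) (K : model L) (A : form L) :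
    form (diagram K) :=
  match A with
  | fPred p ts => @fPred (diagram K) p (map_tuple (diagram_term K) ts)
  | fDef t => fDef (diagram_term K t)
  | fNeg B => fNeg (diagram_form K B)
  | fAnd B C => fAnd (diagram_form K B) (diagram_form K C)
  | fOr B C => fOr (diagram_form K B) (diagram_form K C)
  | fAll x B => fAll x (diagram_form K B)
  | fEx x B => fEx x (diagram_form K B)
  end.

(* The partial function interpreting constants at [w], given by its graph
   since [dom w a] is not decidable. *)
Definition denotes (L : language) (K : model L) (w : world K)
    (c : const (diagram K)) (a : ind K) : Prop :=
  match c with
  | inl c' => cval w c' = Some a
  | inr b => b = a /\ dom w a
  end.

Definition denotes_tuple (L : language) (K : model L) (w : world K) n
    (ts : n.-tuple (term (diagram K))) (us : n.-tuple (ind K)) : Prop :=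
  forall k, exists2 c, tnth ts k = Cst c & denotes w c (tnth us k).

(* [holds w A] is v(A, w) = 1.  Every clause for v is positive, since negation
   is treated through the form of the negated sentence, so that v is the least
   relation closed under the clauses; they are read as equivalences because
   the complexity of the sentences decreases and each shape of sentence has its
   own constructors.  Only sentences matter. *)
Inductive holds (L : language) (K : model L) :
    world K -> form (diagram K) -> Prop :=
  | holds_def w c a : denotes w c a -> holds w (fDef (Cst c))
  | holds_ndef w c :
      (forall a, ~ denotes w c a) -> holds w (fNeg (fDef (Cst c)))
  | holds_pred w (p : predE (diagram K)) (ts : (arityE p).-tuple _)
      (us : (arityE p).-tuple (ind K)) :
      denotes_tuple w ts us -> extension (@ipos L K) (@ppos L K) w us ->
      holds w (fPred ts)
  | holds_npred w (p : predE (diagram K)) (ts : (arityE p).-tuple _)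
      (us : (arityE p).-tuple (ind K)) :
      denotes_tuple w ts us -> extension (@ineg L K) (@pneg L K) w us ->
      holds w (fNeg (fPred ts))
  | holds_and w A B : holds w A -> holds w B -> holds w (fAnd A B)
  | holds_orl w A B : holds w A -> holds w (fOr A B)
  | holds_orr w A B : holds w B -> holds w (fOr A B)
  | holds_nandl w A B : holds w (fNeg A) -> holds w (fNeg (fAnd A B))
  | holds_nandr w A B : holds w (fNeg B) -> holds w (fNeg (fAnd A B))
  | holds_nor w A B :
      holds w (fNeg A) -> holds w (fNeg B) -> holds w (fNeg (fOr A B))
  | holds_nneg w A : holds w A -> holds w (fNeg (fNeg A))
  | holds_all w x A :
      (forall w' a, wle w w' -> dom w' a -> holds w' (subst x (bar a) A)) ->
      holds w (fAll x A)
  | holds_ex w x A a :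
      dom w a -> holds w (subst x (bar a) A) -> holds w (fEx x A)
  | holds_nall w x A a :
      dom w a -> holds w (fNeg (subst x (bar a) A)) -> holds w (fNeg (fAll x A))
  | holds_nex w x A :
      (forall w' a, wle w w' -> dom w' a ->
        holds w' (fNeg (subst x (bar a) A))) ->
      holds w (fNeg (fEx x A)).

Definition satisfies (L : language) (K : model L) (w : world K) (A : form L) :
  Prop := holds w (diagram_form K A).

Definition entails (L : language) (G : set (form L)) (A : form L) : Prop :=
  forall (K : model L) (w : world K),
    (forall B, G B -> satisfies w B) -> satisfies w A.

(* Main.v *)
(* Henkin's construction.  The stages of the canonical model are theories over
   varying sets of constants, ordered by inclusion; an individual is a constant
   and exists at a stage that contains its definedness statement.  If [F] is not
   derivable from a theory, Zorn's lemma extends the theory to a maximal one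
   from which [F] is not derivable, where a new constant may occur only if it is
   the witness of a sentence of the theory, with the instance in the theory.
   This theory is prime and has witnesses, and by PEM and PEX it decides
   definedness consistently.  The codes of formulas, tagged by a natural number,
   serve as new constants: a stage uses only tags below some bound, so there is
   always a fresh constant for a refutation of [fAll] at a later stage.  As the
   new constants can outnumber the old ones, the extension of the language is
   conservative by renaming, one deduction at a time. *)
Require Import Defs.
From mathcomp Require Import all_boot.
From mathcomp Require Import boolp classical_sets functions cardinality.

Set Implicit Arguments.
Unset Strict Implicit.
Unset Printing Implicit Defensive.

Local Open Scope classical_set_scope.

(** * Substitution and derived rules *)

Section Syntax.
Context {L : language}.
Implicit Types (A B C E F : form L) (G H : set (form L)) (c d : const L).

Definition in_lang (S : set (const L)) A : Prop := forall c, occurs c A -> S c.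

Lemma free_subst x y c A : free y (subst x c A) = (y != x) && free y A.
Proof.
have free_subst_term t :
    free_term y (subst_term x c t) = (y != x) && free_term y t.
  case: t => [z|d] /=; last by rewrite andbF.
  case: (eqVneq z x) => [->|zx] /=; first by rewrite eq_sym; case: eqVneq.
  by case: (eqVneq z y) => [<-|]; rewrite ?zx ?andbF.
elim: A => /=.
- by move=> p ts; elim: (tval ts) => [|t s IH] /=;
    rewrite ?andbF // free_subst_term IH andb_orr.
- exact: free_subst_term.
- by [].
- by move=> A -> B ->; rewrite andb_orr.
- by move=> A -> B ->; rewrite andb_orr.
- move=> z A IH; case: eqVneq => [->|zx] /=; last by rewrite IH andbCA.
  by rewrite [x == y]eq_sym andbA andbb.
- move=> z A IH; case: eqVneq => [->|zx] /=; last by rewrite IH andbCA.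
  by rewrite [x == y]eq_sym andbA andbb.
Qed.

Lemma occurs_subst x c d A : occurs d (subst x c A) -> d = c \/ occurs d A.
Proof.
have occurs_term t : subst_term x c t = Cst d -> d = c \/ t = Cst d.
  by case: t => [y|e] /=; [case: ifP => // _ [->]; left | right].
elim: A => //=.
- by move=> p ts [i]; rewrite tnth_map => /occurs_term[]; [left|right; exists i].
- by move=> A IHA B IHB [/IHA|/IHB] []; tauto.
- by move=> A IHA B IHB [/IHA|/IHB] []; tauto.
- by move=> y A IH; case: ifP => _ /=; [right|].
- by move=> y A IH; case: ifP => _ /=; [right|].
Qed.

Lemma occurs_substr x c d A : occurs d A -> occurs d (subst x c A).
Proof.
elim: A => //=.
- by move=> p ts [i ti]; exists i; rewrite tnth_map ti.
- by move=> t ->.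
- by move=> A IHA B IHB [/IHA|/IHB]; tauto.
- by move=> A IHA B IHB [/IHA|/IHB]; tauto.
- by move=> y A IH; case: ifP.
- by move=> y A IH; case: ifP.
Qed.

Lemma in_lang_subst S x c A : S c -> in_lang S A -> in_lang S (subst x c A).
Proof. by move=> Sc SA d /occurs_subst[->|/SA]. Qed.

Lemma finite_occurs A : finite_set [set c | occurs c A].
Proof.
have finite_eq (t : term L) : finite_set [set c | t = Cst c].
  case: t => [x|d]; last by apply: (sub_finite_set _ (finite_set1 d)) => c [->].
  by apply: (sub_finite_set _ (finite_set0 _)).
elim: A => //=.
- move=> p ts; apply: (@sub_finite_set _ _
    (\bigcup_(i in [set: 'I_(arityE p)]) [set c | tnth ts i = Cst c])).
    by move=> c [i ti]; exists i.
  by apply: bigcup_finite => // i _; exact: finite_eq.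
- move=> A IHA B IHB.
  by change (finite_set ([set c | occurs c A] `|` [set c | occurs c B]));
    rewrite finite_setU.
- move=> A IHA B IHB.
  by change (finite_set ([set c | occurs c A] `|` [set c | occurs c B]));
    rewrite finite_setU.
Qed.

Lemma sentence_subst x c A : sentence (fAll x A) -> sentence (subst x c A).
Proof. by move=> sA y; rewrite free_subst eq_sym; exact: sA. Qed.

Lemma sentence_forall x c A : sentence (subst x c A) -> sentence (fAll x A).
Proof. by move=> sA y /=; rewrite eq_sym -(free_subst x y c); exact: sA. Qed.

Lemma sentence_and A B : sentence (fAnd A B) <-> sentence A /\ sentence B.
Proof.
split=> [sAB|[sA sB] x]; last by rewrite /= negb_or sA sB.
by split=> x; have := sAB x; rewrite /= negb_or => /andP[].
Qed.

Lemma sentence_pred (p : predE L) (ts : (arityE p).-tuple (term L)) :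
  sentence (fPred ts) <-> forall i, exists c, tnth ts i = Cst c.
Proof.
split=> [s i|s x].
  case ti: (tnth ts i) => [x|c]; last by exists c.
  suff hx : free x (fPred ts) by have := s x; rewrite hx.
  by apply/has_tnthP; exists i; rewrite ti /= eqxx.
by apply/negP => /has_tnthP[i]; have [c ->] := s i.
Qed.

Lemma sentence_def (t : term L) : sentence (fDef t) <-> exists c, t = Cst c.
Proof.
split=> [s|[c ->] x //]; case: t s => [x|c] s; last by exists c.
by have := s x; rewrite /= eqxx.
Qed.

Lemma ded_sentence H A : ded H A -> sentence A.
Proof.
elim=> //.
(* [free] computes alike on conjunctions and disjunctions and ignores negations, so [sentence_and]
   applies to all binary compounds by conversion; [sentence_forall] does the same below for all
   quantified ones. *)
all: try by move=> *; apply/sentence_and; split.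
all: try by move=> ? ? ? _ /sentence_and[].
all: try by move=> ? ? ? ? ? ? ? ? _ /sentence_and[].
- move=> {}H p ts i _ /sentence_pred/(_ i)[c ->]; by apply/sentence_def; exists c.
- move=> {}H p ts i _ /sentence_pred/(_ i)[c ->]; by apply/sentence_def; exists c.
- by move=> {}H x c B _ /sentence_forall.
- by move=> H1 H2 x c B _ /sentence_subst sB _ _; exact: sB.
- by move=> H1 H2 x c B _ /sentence_forall.
- by move=> H1 H2 x c B _ /sentence_forall.
- by move=> {}H x c B _ /sentence_forall.
- by move=> H1 H2 x c B _ /sentence_subst sB _ _; exact: sB.
- move=> H1 H2 x c1 c2 B _ _ sB _ _ y.
  by rewrite free_subst -(free_subst x y c1); exact: sB.
Qed.

Lemma ded_finite H A : ded H A -> finite_set H.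
Proof.
by elim=> *; rewrite ?finite_setU; do ?split => //; do ?apply: finite_setD.
Qed.

Lemma der_sentence G A : derivable G A -> sentence A.
Proof. by move=> [H _ /ded_sentence]. Qed.

Lemma der_hyp G A : sentence A -> G A -> derivable G A.
Proof. by move=> sA GA; exists [set A]; [move=> _ ->|exact: ded_hyp]. Qed.

Lemma der_weak G G' A : G `<=` G' -> derivable G A -> derivable G' A.
Proof. by move=> GG' [H HG dA]; exists H => //; exact: subset_trans GG'. Qed.

Lemma der_orE G A B C : derivable G (fOr A B) -> derivable (A |` G) C ->
  derivable (B |` G) C -> derivable G C.
Proof.
move=> [H HG d] [H1 HG1 d1] [H2 HG2 d2]; exists (H `|` (H1 `\ A) `|` (H2 `\ B)).
  by move=> D [[/HG //|[/HG1[]]]|[/HG2[]]].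
exact: ded_orE d d1 d2.
Qed.

Lemma der_nandE G A B C : derivable G (fNeg (fAnd A B)) ->
  derivable (fNeg A |` G) C -> derivable (fNeg B |` G) C -> derivable G C.
Proof.
move=> [H HG d] [H1 HG1 d1] [H2 HG2 d2].
exists (H `|` (H1 `\ fNeg A) `|` (H2 `\ fNeg B)).
  by move=> D [[/HG //|[/HG1[]]]|[/HG2[]]].
exact: ded_nandE d d1 d2.
Qed.

(* A tree is grafted onto the hypotheses [A] by way of the rules for A \/ A. *)
Lemma der_cut G A B : derivable G A -> derivable (A |` G) B -> derivable G B.
Proof.
move=> [H HG d] dB; have sA := ded_sentence d.
by apply: (der_orE (A := A) (B := A)) => //; exists H => //; exact: ded_orIl.
Qed.

Lemma der1 G A B :
  (forall H, ded H A -> ded H B) -> derivable G A -> derivable G B.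
Proof. by move=> r [H HG d]; exists H => //; exact: r. Qed.

Lemma der2 G A B C :
  (forall H1 H2, ded H1 A -> ded H2 B -> ded (H1 `|` H2) C) ->
  derivable G A -> derivable G B -> derivable G C.
Proof.
move=> r [H HG d] [H' HG' d']; exists (H `|` H'); last exact: r.
by move=> D [/HG|/HG'].
Qed.

(** The eigenvariable condition is put on all of [G]; a deduction uses only part of [G], so the side
    condition of the rule follows. *)
Lemma der_allI G x c A : derivable (fDef (Cst c) |` G) (subst x c A) ->
  ~ occurs c A -> (forall B, G B -> ~ occurs c B) -> derivable G (fAll x A).
Proof.
move=> [H HG d] cA cG; have HG' : H `\ fDef (Cst c) `<=` G.
  by move=> B [/HG[]].
by exists (H `\ fDef (Cst c)) => //; apply: ded_allI d cA _ => B /HG'/cG.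
Qed.

Lemma der_nexI G x c A : derivable (fDef (Cst c) |` G) (fNeg (subst x c A)) ->
  ~ occurs c A -> (forall B, G B -> ~ occurs c B) ->
  derivable G (fNeg (fEx x A)).
Proof.
move=> [H HG d] cA cG; have HG' : H `\ fDef (Cst c) `<=` G.
  by move=> B [/HG[]].
by exists (H `\ fDef (Cst c)) => //; apply: ded_nexI d cA _ => B /HG'/cG.
Qed.

(** Two sets of hypotheses, because the eigenvariable has to be fresh only for those of the minor
    derivation; the major premise may rest on sentences of [G] that mention [c]. *)
Lemma der_exE G G' x c A B : derivable G (fEx x A) ->
  derivable (subst x c A |` (fDef (Cst c) |` G')) B ->
  ~ occurs c A -> ~ occurs c B -> (forall C, G' C -> ~ occurs c C) ->
  derivable (G `|` G') B.
Proof.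
move=> [H HG d] [H1 HG1 d1] cA cB cG.
have HG' : H1 `\ subst x c A `\ fDef (Cst c) `<=` G'.
  by move=> C [[/HG1[|[]]]].
exists (H `|` (H1 `\ subst x c A `\ fDef (Cst c))).
  by move=> C [/HG|/HG']; [left|right].
by apply: ded_exE d d1 cA cB _ => C /HG'/cG.
Qed.

Lemma der_nallE G G' x c A B : derivable G (fNeg (fAll x A)) ->
  derivable (fNeg (subst x c A) |` (fDef (Cst c) |` G')) B ->
  ~ occurs c A -> ~ occurs c B -> (forall C, G' C -> ~ occurs c C) ->
  derivable (G `|` G') B.
Proof.
move=> [H HG d] [H1 HG1 d1] cA cB cG.
have HG' : H1 `\ fNeg (subst x c A) `\ fDef (Cst c) `<=` G'.
  by move=> C [[/HG1[|[]]]].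
exists (H `|` (H1 `\ fNeg (subst x c A) `\ fDef (Cst c))).
  by move=> C [/HG|/HG']; [left|right].
by apply: ded_nallE d d1 cA cB _ => C /HG'/cG.
Qed.

Lemma der_def G (p : predE L) (ts : (arityE p).-tuple (term L)) i :
  derivable G (fPred ts) -> derivable G (fDef (tnth ts i)).
Proof. by apply: der1 => H; exact: ded_DI_pos. Qed.

Lemma der_ndef G (p : predE L) (ts : (arityE p).-tuple (term L)) i :
  derivable G (fNeg (fPred ts)) -> derivable G (fDef (tnth ts i)).
Proof. by apply: der1 => H; exact: ded_DI_neg. Qed.

Lemma der_PEM G c : derivable G (fOr (fDef (Cst c)) (fNeg (fDef (Cst c)))).
Proof. by exists set0 => //; exact: ded_PEM. Qed.

End Syntax.

(** * Renaming of constants in deductions *)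

Section Renaming.
Context {P : Type} {ar : P -> nat}.

(** Keeps the predicate letters fixed and varies the constants, so that atoms need no transport of
    arities along a renaming. *)
Definition lang_on C (iC : infinite_set [set: C]) := @Language C P ar iC.

Section Rename.
Context {C1 C2 : Type} {i1 : infinite_set [set: C1]}
  {i2 : infinite_set [set: C2]}.
Variable f : const (lang_on i1) -> const (lang_on i2).

Definition rename_term (t : term (lang_on i1)) : term (lang_on i2) :=
  match t with Var x => Var x | Cst c => Cst (f c) end.

Fixpoint rename (A : form (lang_on i1)) : form (lang_on i2) :=
  match A with
  | fPred p ts => @fPred (lang_on i2) p (map_tuple rename_term ts)
  | fDef t => fDef (rename_term t)
  | fNeg B => fNeg (rename B)
  | fAnd B C => fAnd (rename B) (rename C)
  | fOr B C => fOr (rename B) (rename C)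
  | fAll x B => fAll x (rename B)
  | fEx x B => fEx x (rename B)
  end.

Lemma rename_subst x c A : rename (subst x c A) = subst x (f c) (rename A).
Proof.
have term_subst t : rename_term (subst_term x c t) =
    subst_term x (f c) (rename_term t).
  by case: t => [y|d] //=; case: ifP.
elim: A => //=.
- move=> p ts; congr (@fPred (lang_on i2) p _); apply: eq_from_tnth => i.
  by rewrite !tnth_map term_subst.
- by move=> t; rewrite term_subst.
- by move=> A ->.
- by move=> A -> B ->.
- by move=> A -> B ->.
- by move=> y A IH; case: ifP => //= _; rewrite IH.
- by move=> y A IH; case: ifP => //= _; rewrite IH.
Qed.

Lemma occurs_rename d A :
  occurs d (rename A) <-> exists2 c, f c = d & occurs c A.
Proof.
have occurs_term t : rename_term t = Cst d <->
    exists2 c, f c = d & t = Cst c.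
  case: t => [y|c] /=; split=> [|[c' //]]; first by [].
  - by case=> <-; exists c.
  - by move=> fc [->]; rewrite fc.
elim: A => /=.
- move=> p ts; split.
    move=> [i]; rewrite tnth_map => /occurs_term[c cd ti].
    by exists c => //; exists i.
  by move=> [c cd [i ti]]; exists i; rewrite tnth_map; apply/occurs_term; exists c.
- exact: occurs_term.
- by [].
- move=> A IHA B IHB; split.
    by move=> [/IHA|/IHB] [c]; exists c; auto.
  by move=> [c cd [cA|cB]]; [left; apply/IHA|right; apply/IHB]; exists c.
- move=> A IHA B IHB; split.
    by move=> [/IHA|/IHB] [c]; exists c; auto.
  by move=> [c cd [cA|cB]]; [left; apply/IHA|right; apply/IHB]; exists c.
- by [].
- by [].
Qed.

Lemma free_rename x A : free x (rename A) = free x A.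
Proof.
have free_term_rename t : free_term x (rename_term t) = free_term x t.
  by case: t.
elim: A => //=.
- by move=> p ts; rewrite has_map; apply: eq_has => t; exact: free_term_rename.
- by move=> A -> B ->.
- by move=> A -> B ->.
- by move=> y A ->.
- by move=> y A ->.
Qed.

Lemma sentence_rename A : sentence (rename A) <-> sentence A.
Proof. by split=> sA x; have := sA x; rewrite free_rename. Qed.

Lemma atomic_rename A : atomic (rename A) = atomic A.
Proof. by case: A. Qed.

Lemma literal_rename A : literal (rename A) = literal A.
Proof. by case: A => //= B; exact: atomic_rename. Qed.

Lemma rename_eq s t : rename (fEq s t) = fEq (rename_term s) (rename_term t).
Proof.
congr (@fPred (lang_on i2) None _); apply: eq_from_tnth => i.
by rewrite tnth_map !(tnth_nth (Var 0)); case: i => [[|[]]].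
Qed.

(** Valid for every [f], injective or not: this inclusion is what a discharging rule needs after
    renaming. *)
Lemma rename_discharge A H : rename @` H `<=` rename A |` rename @` (H `\ A).
Proof.
move=> _ [B HB <-]; have [->|AB] := pselect (B = A); first by left.
by right; exists B.
Qed.

Lemma rename_discharge2 A B H :
  rename @` H `<=` rename A |` (rename B |` rename @` (H `\ A `\ B)).
Proof.
apply: (subset_trans (@rename_discharge A H)); apply: setUS.
exact: rename_discharge.
Qed.

End Rename.

Lemma rename_comp C1 C2 C3 (i1 : infinite_set [set: C1])
    (i2 : infinite_set [set: C2]) (i3 : infinite_set [set: C3])
    (f : const (lang_on i1) -> const (lang_on i2))
    (g : const (lang_on i2) -> const (lang_on i3)) A :
  rename g (rename f A) = rename (g \o f) A.
Proof.
have comp_term t : rename_term g (rename_term f t) =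
    rename_term (g \o f) t by case: t.
elim: A => //=.
- move=> p ts; congr (@fPred (lang_on i3) p _); apply: eq_from_tnth => i.
  by rewrite !tnth_map comp_term.
- by move=> t; rewrite comp_term.
- by move=> A ->.
- by move=> A -> B ->.
- by move=> A -> B ->.
- by move=> x A ->.
- by move=> x A ->.
Qed.

Lemma rename_id C (iC : infinite_set [set: C])
    (f : const (lang_on iC) -> const (lang_on iC)) A :
  (forall c, occurs c A -> f c = c) -> rename f A = A.
Proof.
have id_term (t : term (lang_on iC)) :
    (forall c, t = Cst c -> f c = c) -> rename_term f t = t.
  by case: t => //= c /(_ _ erefl) ->.
elim: A => //=.
- move=> p ts h; congr (@fPred (lang_on iC) p _); apply: eq_from_tnth => i.
  by rewrite !tnth_map id_term // => c ti; apply: h; exists i.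
- by move=> t h; rewrite id_term.
- by move=> A IH /IH ->.
- by move=> A IHA B IHB h; rewrite IHA ?IHB // => c oc; apply: h; auto.
- by move=> A IHA B IHB h; rewrite IHA ?IHB // => c oc; apply: h; auto.
- by move=> x A IH /IH ->.
- by move=> x A IH /IH ->.
Qed.

(** * Renamings that are injective on a finite set of constants *)

Section RenameDed.
Context {C1 C2 : Type} {i1 : infinite_set [set: C1]}
  {i2 : infinite_set [set: C2]}.
Notation L1 := (lang_on i1).
Notation L2 := (lang_on i2).
Implicit Types (f : const L1 -> const L2) (H : set (form L1)) (A B : form L1)
  (G K : set (form L2)) (c d : const L1).

Definition inj_on (S : set (const L1)) f : Prop :=
  forall x y, S x -> S y -> f x = f y -> x = y.

Lemma inj_onS S S' f : S `<=` S' -> inj_on S' f -> inj_on S f.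
Proof. by move=> SS' fS x y /SS' Sx /SS' Sy; exact: fS. Qed.

(** [S] collects the constants that a renaming must keep apart to respect the eigenvariable
    conditions of a deduction. The target is [derivable] because a renaming may identify hypotheses,
    so that a discharge may remove more of them. *)
Definition ren_der H A : Prop := exists2 S, finite_set S &
  forall f, inj_on S f -> derivable (rename f @` H) (rename f A).

Lemma ren_der0 H A :
  (forall f, derivable (rename f @` H) (rename f A)) ->
  ren_der H A.
Proof. by move=> dA; exists set0. Qed.

Lemma ren_der1 S' H H' A B : finite_set S' ->
  (forall f, inj_on S' f -> derivable (rename f @` H) (rename f A) ->
     derivable (rename f @` H') (rename f B)) ->
  ren_der H A -> ren_der H' B.
Proof.
move=> finS' dB [S finS dA]; exists (S' `|` S); first by rewrite finite_setU.
move=> f fS; apply: dB; first by apply: inj_onS fS; exact: subsetUl.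
by apply: dA; apply: inj_onS fS; exact: subsetUr.
Qed.

Lemma ren_der2 S' H1 H2 H' A B C : finite_set S' ->
  (forall f, inj_on S' f -> derivable (rename f @` H1) (rename f A) ->
     derivable (rename f @` H2) (rename f B) ->
     derivable (rename f @` H') (rename f C)) ->
  ren_der H1 A -> ren_der H2 B -> ren_der H' C.
Proof.
move=> finS' dC [S1 fin1 dA] [S2 fin2 dB].
exists (S' `|` (S1 `|` S2)); first by rewrite !finite_setU.
move=> f fS; apply: dC; first by apply: inj_onS fS => x Sx; left.
  by apply: dA; apply: inj_onS fS => x Sx; right; left.
by apply: dB; apply: inj_onS fS => x Sx; right; right.
Qed.

Definition used (H : set (form L1)) : set (const L1) :=
  \bigcup_(A in H) [set c | occurs c A].

Lemma finite_used H : finite_set H -> finite_set (used H).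
Proof. by move=> finH; apply: bigcup_finite => // A _; exact: finite_occurs. Qed.

Lemma rename_fresh S f c A : inj_on S f -> S c ->
  (forall d, occurs d A -> S d) -> ~ occurs c A ->
  ~ occurs (f c) (rename f A).
Proof.
move=> fS Sc SA cA /occurs_rename[d fd dA]; apply: cA.
by rewrite -(fS d c) //; exact: SA.
Qed.

Lemma rename_freshs S f c H : inj_on S f -> S c -> used H `<=` S ->
  (forall A, H A -> ~ occurs c A) ->
  forall B : form L2, (rename f @` H) B -> ~ occurs (f c) B.
Proof.
move=> fS Sc SH cH _ [A HA <-]; apply: rename_fresh fS Sc _ _; last exact: cH.
by move=> d dA; apply: SH; exists A.
Qed.

Lemma ren_rule1 H A B :
  (forall f K, ded K (rename f A) -> ded K (rename f B)) ->
  ren_der H A -> ren_der H B.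
Proof.
by move=> r; apply: (ren_der1 (finite_set0 _)) => f _; exact/der1/r.
Qed.

Lemma ren_rule2 H1 H2 A B C :
  (forall f K1 K2, ded K1 (rename f A) -> ded K2 (rename f B) ->
     ded (K1 `|` K2) (rename f C)) ->
  ren_der H1 A -> ren_der H2 B -> ren_der (H1 `|` H2) C.
Proof.
move=> r; apply: (ren_der2 (finite_set0 _)) => f _ d1 d2.
rewrite image_setU; apply: der2 (r f) _ _.
  by apply: der_weak d1; exact: subsetUl.
by apply: der_weak d2; exact: subsetUr.
Qed.

(** Common form of [ded_orE] and [ded_nandE]. No eigenvariable is involved, so nothing is asked of
    [f] beyond what the three premises ask. *)
Lemma ren_ruleE H H1 H2 H' A B1 B2 C :
  (forall f G, derivable G (rename f A) ->
    derivable (rename f B1 |` G) (rename f C) ->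
    derivable (rename f B2 |` G) (rename f C) -> derivable G (rename f C)) ->
  H' = H `|` (H1 `\ B1) `|` (H2 `\ B2) ->
  ren_der H A -> ren_der H1 C -> ren_der H2 C -> ren_der H' C.
Proof.
move=> r ->; set K' := H `|` _ `|` _.
move=> [S finS d] [S1 fin1 d1] [S2 fin2 d2].
exists (S `|` (S1 `|` S2)); first by rewrite !finite_setU.
move=> f fS; apply: r.
- apply: der_weak (d f _); last by apply: inj_onS fS => x Sx; left.
  by apply: image_subset => D HD; left; left.
- apply: der_weak (d1 f _); last by apply: inj_onS fS => x Sx; right; left.
  apply: subset_trans (@rename_discharge _ _ _ _ f B1 H1) _; apply: setUS.
  by apply: image_subset => D HD; left; right.
- apply: der_weak (d2 f _); last by apply: inj_onS fS => x Sx; right; right.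
  apply: subset_trans (@rename_discharge _ _ _ _ f B2 H2) _; apply: setUS.
  by apply: image_subset => D HD; right.
Qed.

(* Common form of [ded_allI] and [ded_nexI]. *)
Lemma ren_ruleI H c A B (D : form L1) : finite_set H ->
  (forall f G, derivable (fDef (Cst (f c)) |` G) (rename f A) ->
    ~ occurs (f c) (rename f D) -> (forall C, G C -> ~ occurs (f c) C) ->
    derivable G (rename f B)) ->
  ~ occurs c D -> (forall C, (H `\ fDef (Cst c)) C -> ~ occurs c C) ->
  ren_der H A -> ren_der (H `\ fDef (Cst c)) B.
Proof.
move=> finH r cD cH.
(* Injectivity on the eigenvariable, the constants of [D] and those of the remaining hypotheses
   keeps [f c] away from the images of these formulas. *)
pose S := c |` ([set d | occurs d D] `|` used (H `\ fDef (Cst c))).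
apply: (ren_der1 (S' := S)).
  rewrite !finite_setU; split; first exact: finite_set1.
  by split; [exact: finite_occurs | apply: finite_used; exact: finite_setD].
move=> f fS dA; apply: r.
- by apply: der_weak dA; exact: (@rename_discharge _ _ _ _ f (fDef (Cst c))).
- by apply: rename_fresh fS _ _ cD; [left | move=> d dD; right; left].
- by apply: rename_freshs fS _ _ cH; [left | move=> d dD; right; right].
Qed.

(* Common form of [ded_exE] and [ded_nallE]. *)
Lemma ren_ruleE2 H1 H2 c A B C (D : form L1) : finite_set H2 ->
  (forall f G G', derivable G (rename f A) ->
    derivable (rename f C |` (fDef (Cst (f c)) |` G')) (rename f B) ->
    ~ occurs (f c) (rename f D) -> ~ occurs (f c) (rename f B) ->
    (forall C, G' C -> ~ occurs (f c) C) ->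
    derivable (G `|` G') (rename f B)) ->
  ~ occurs c D -> ~ occurs c B ->
  (forall E, (H2 `\ C `\ fDef (Cst c)) E -> ~ occurs c E) ->
  ren_der H1 A -> ren_der H2 B ->
  ren_der (H1 `|` (H2 `\ C `\ fDef (Cst c))) B.
Proof.
move=> finH2 r cD cB cH; set H := H2 `\ C `\ _.
pose S := c |` ([set d | occurs d D] `|` ([set d | occurs d B] `|` used H)).
apply: (ren_der2 (S' := S)).
  rewrite !finite_setU; split; first exact: finite_set1.
  split; [exact: finite_occurs | split; first exact: finite_occurs].
  by apply: finite_used; do 2!apply: finite_setD.
move=> f fS dA dB; rewrite image_setU.
apply: r => //.
- by apply: der_weak dB; exact: (@rename_discharge2 _ _ _ _ f C (fDef (Cst c))).
- by apply: rename_fresh fS _ _ cD; [left | move=> d dD; right; left].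
- by apply: rename_fresh fS _ _ cB; [left | move=> d dD; right; right; left].
- by apply: rename_freshs fS _ _ cH; [left | move=> d dD; do 3!right].
Qed.

(** A rule without eigenvariable survives an arbitrary renaming. An eigenvariable rule adds finitely
    many constants to the set of injectivity, since the hypotheses of a deduction are finite in
    number. *)
Lemma ded_rename H A : ded H A -> ren_der H A.
Proof.
elim=> {H A}.
- move=> A sA; apply: ren_der0 => f; apply: der_hyp; first exact/sentence_rename.
  by exists A.
- move=> H1 H2 A B _ IH1 _ IH2.
  by apply: ren_rule2 IH1 IH2 => f K1 K2; exact: ded_andI.
- by move=> H A B _; apply: ren_rule1 => f K; exact: ded_andEl.
- by move=> H A B _; apply: ren_rule1 => f K; exact: ded_andEr.
- move=> H A B sB _; apply: ren_rule1 => f K.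
  by apply: ded_orIl; exact/sentence_rename.
- move=> H A B sB _; apply: ren_rule1 => f K.
  by apply: ded_orIr; exact/sentence_rename.
- move=> H H1 H2 A B C _ IH _ IH1 _ IH2.
  by apply: ren_ruleE erefl IH IH1 IH2 => f G; exact: der_orE.
- move=> H A B sB _; apply: ren_rule1 => f K.
  by apply: ded_nandIl; exact/sentence_rename.
- move=> H A B sB _; apply: ren_rule1 => f K.
  by apply: ded_nandIr; exact/sentence_rename.
- move=> H H1 H2 A B C _ IH _ IH1 _ IH2.
  by apply: ren_ruleE erefl IH IH1 IH2 => f G; exact: der_nandE.
- move=> H1 H2 A B _ IH1 _ IH2.
  by apply: ren_rule2 IH1 IH2 => f K1 K2; exact: ded_norI.
- by move=> H A B _; apply: ren_rule1 => f K; exact: ded_norEl.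
- by move=> H A B _; apply: ren_rule1 => f K; exact: ded_norEr.
- by move=> H A _; apply: ren_rule1 => f K; exact: ded_DNI.
- by move=> H A _; apply: ren_rule1 => f K; exact: ded_DNE.
- move=> H p ts i _; apply: ren_rule1 => f K /=.
  rewrite -(tnth_map (rename_term f)); exact: ded_DI_pos.
- move=> H p ts i _; apply: ren_rule1 => f K /=.
  rewrite -(tnth_map (rename_term f)); exact: ded_DI_neg.
- move=> H1 H2 c B sB _ IH1 _ IH2; apply: ren_rule2 IH1 IH2 => f K1 K2.
  by apply: ded_PEX; exact/sentence_rename.
- by move=> c; apply: ren_der0 => f; exact: der_PEM.
- move=> H x c A dA IH cA cH; apply: (ren_ruleI (ded_finite dA)) cA cH IH.
  by move=> f G; rewrite rename_subst; exact: der_allI.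
- move=> H1 H2 x c A _ IH1 _ IH2; apply: ren_rule2 IH1 IH2 => f K1 K2.
  by rewrite rename_subst; exact: ded_allE.
- move=> H1 H2 x c A _ IH1 _ IH2; apply: ren_rule2 IH1 IH2 => f K1 K2.
  by rewrite rename_subst; exact: ded_exI.
- move=> H1 H2 x c A B _ IH1 d2 IH2 cA cB cH.
  apply: (ren_ruleE2 (ded_finite d2)) cA cB cH IH1 IH2.
  by move=> f G G'; rewrite rename_subst; exact: der_exE.
- move=> H1 H2 x c A _ IH1 _ IH2; apply: ren_rule2 IH1 IH2 => f K1 K2 /=.
  by rewrite rename_subst; exact: ded_nallI.
- move=> H1 H2 x c A B _ IH1 d2 IH2 cA cB cH.
  apply: (ren_ruleE2 (ded_finite d2)) cA cB cH IH1 IH2.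
  by move=> f G G' /=; rewrite rename_subst; exact: der_nallE.
- move=> H x c A dA IH cA cH; apply: (ren_ruleI (ded_finite dA)) cA cH IH.
  by move=> f G /=; rewrite rename_subst; exact: der_nexI.
- move=> H1 H2 x c A _ IH1 _ IH2; apply: ren_rule2 IH1 IH2 => f K1 K2 /=.
  by rewrite rename_subst; exact: ded_nexE.
- move=> H c _; apply: ren_rule1 => f K; rewrite rename_eq; exact: ded_eqI.
- move=> H1 H2 x c1 c2 A lA _ IH1 _ IH2; apply: ren_rule2 IH1 IH2 => f K1 K2.
  rewrite rename_eq !rename_subst; apply: ded_eqE.
  by rewrite literal_rename.
- move=> H1 H2 x c1 c2 A aA xA _ IH1 _ IH2; apply: ren_rule2 IH1 IH2 => f K1 K2.
  have -> : rename f (fNeg (fEq (Cst c1) (Cst c2))) =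
      fNeg (fEq (Cst (f c1)) (Cst (f c2))).
    by congr fNeg; exact: rename_eq.
  rewrite [rename f (fNeg _)]/= !rename_subst.
  by apply: ded_neqI; rewrite ?atomic_rename ?free_rename.
Qed.

End RenameDed.

End Renaming.

(** * Prime theories with witnesses *)

Section Lindenbaum.
Context {L : language}.
Implicit Types (A B F : form L) (G H T X : set (form L)) (c d : const L)
  (D : set (const L)).

(* The sentences that call for a witness, with the matrix to be witnessed. *)
Definition matrix_of F : option (nat * form L) :=
  match F with
  | fEx x B => Some (x, B)
  | fNeg (fAll x B) => Some (x, fNeg B)
  | _ => None
  end.

Lemma occurs_matrix F x B c :
  matrix_of F = Some (x, B) -> occurs c F <-> occurs c B.
Proof. by case: F => // [[]|] //= ? ? [_ <-]. Qed.

Lemma matrix_sentence F B x c :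
  matrix_of F = Some (x, B) -> sentence F -> sentence (subst x c B).
Proof.
move=> FB sF; apply: sentence_subst => y; have := sF y.
by case: F FB {sF} => // [[]|] //= ? ? [<- <-].
Qed.

Lemma der_matrixE G F x c B C : matrix_of F = Some (x, B) -> derivable G F ->
  derivable (subst x c B |` (fDef (Cst c) |` G)) C ->
  ~ occurs c B -> ~ occurs c C -> (forall E, G E -> ~ occurs c E) ->
  derivable G C.
Proof.
(* The rules keep the hypotheses of their two premises apart; here both sets are [G]. *)
rewrite -[X in _ -> _ -> _ -> _ -> _ -> derivable X C](setUid G).
by case: F => // [[]|] //= y B' [-> <-]; [exact: der_nallE | exact: der_exE].
Qed.

Lemma der_matrixI G F x c B : matrix_of F = Some (x, B) ->
  derivable G (subst x c B) -> derivable G (fDef (Cst c)) -> derivable G F.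
Proof.
case: F => // [[]|] //= y B' [-> <-]; apply: der2 => H1 H2;
  [exact: ded_nallI | exact: ded_exI].
Qed.

(* Dually, the sentences that speak about all later stages. *)
Definition universal_of F : option (nat * form L) :=
  match F with
  | fAll x B => Some (x, B)
  | fNeg (fEx x B) => Some (x, fNeg B)
  | _ => None
  end.

Lemma occurs_universal F x B c :
  universal_of F = Some (x, B) -> occurs c F <-> occurs c B.
Proof. by case: F => // [[]|] //= ? ? [_ <-]. Qed.

Lemma universal_sentence F B x c :
  universal_of F = Some (x, B) -> sentence F -> sentence (subst x c B).
Proof.
move=> FB sF; apply: sentence_subst => y; have := sF y.
by case: F FB {sF} => // [[]|] //= ? ? [<- <-].
Qed.

Lemma der_universalI G F x c B : universal_of F = Some (x, B) ->
  derivable (fDef (Cst c) |` G) (subst x c B) ->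
  ~ occurs c B -> (forall E, G E -> ~ occurs c E) -> derivable G F.
Proof.
by case: F => // [[]|] //= y B' [-> <-]; [exact: der_nexI | exact: der_allI].
Qed.

Lemma der_universalE G F x c B : universal_of F = Some (x, B) ->
  derivable G F -> derivable G (fDef (Cst c)) -> derivable G (subst x c B).
Proof.
case: F => // [[]|] //= y B' [-> <-]; apply: der2 => H1 H2;
  [exact: ded_nexE | exact: ded_allE].
Qed.

Record theory T D : Prop := Theory {
  theory_sentence : forall B, T B -> sentence B;
  theory_in_lang : forall B, T B -> in_lang D B;
  theory_closed : forall B, sentence B -> in_lang D B -> derivable T B -> T B }.

(** What the truth clauses demand of a single stage beyond deductive closure; the universal
    sentences concern later stages and are treated there. *)
Record saturated T D : Prop := Saturated {
  saturated_or : forall A B, T (fOr A B) -> T A \/ T B;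
  saturated_nand : forall A B, T (fNeg (fAnd A B)) -> T (fNeg A) \/ T (fNeg B);
  saturated_witness : forall F x B, matrix_of F = Some (x, B) -> T F ->
    exists c, T (fDef (Cst c)) /\ T (subst x c B);
  saturated_def : forall c, D c -> T (fDef (Cst c)) \/ T (fNeg (fDef (Cst c)));
  saturated_consistent : forall c,
    T (fDef (Cst c)) -> ~ T (fNeg (fDef (Cst c))) }.

(** Lets a deduction from the union of a chain be carried out in one member. The first alternative
    accounts for the empty chain. *)
Lemma finite_sub_bigcup G (Z : set (set (form L))) H : finite_set H ->
  total_on Z subset -> H `<=` G `|` \bigcup_(X in Z) X ->
  H `<=` G \/ exists2 X, Z X & H `<=` G `|` X.
Proof.
move=> /(@finite_seqP {classic form L})[s ->] {H} Ztot.
elim: s => [|B s IH] HZ; first by left.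
have sZ : [set` s] `<=` G `|` \bigcup_(X in Z) X.
  by move=> C Cs; apply: HZ; rewrite /= inE Cs orbT.
have sub X : G B \/ X B -> [set` s] `<=` G `|` X -> [set` B :: s] `<=` G `|` X.
  by move=> BX sX C /=; rewrite inE => /predU1P[-> //|/sX].
have [|GB|[X ZX XB]] := HZ B; first by rewrite /= inE eqxx.
- have [sG|[X ZX sX]] := IH sZ; [left|right].
    have := sub set0; rewrite setU0; apply => //; by left.
  by exists X => //; apply: sub => //; left.
- right; have [sG|[Y ZY sY]] := IH sZ.
    by exists X => //; apply: sub; [right|move=> C /sG; left].
  have [XY|YX] := Ztot X Y ZX ZY.
    by exists Y => //; apply: sub => //; right; exact: XY.
  exists X => //; apply: sub; first by right.
  by move=> C /sY[]; [left|move=> /YX; right].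
Qed.

(** * Maximal extensions by Zorn's lemma *)

Section Extend.
Variables (T0 : set (form L)) (D0 : set (const L)) (E : form L)
  (wit : form L -> const L).
Hypotheses (wit_inj : injective wit) (wit_fresh : forall F, ~ D0 (wit F))
  (T0_sentence : forall B, T0 B -> sentence B)
  (T0_in_lang : forall B, T0 B -> in_lang D0 B)
  (E_sentence : sentence E) (E_in_lang : in_lang D0 E) (T0E : ~ derivable T0 E).

(** [wit F] enters the language only together with its definedness and its instance. Hence for each
    [F] this constant is either already a witness of [F] or fresh for the theory. *)
Definition witnessed T c : Prop := exists F x B,
  [/\ c = wit F, matrix_of F = Some (x, B), T F, T (fDef (Cst c)) &
      T (subst x c B)].

Definition witness_lang T : set (const L) := D0 `|` [set c | witnessed T c].

Lemma witness_langS T T' : T `<=` T' -> witness_lang T `<=` witness_lang T'.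
Proof.
by move=> TT' c [|[F [x [B [? ? ? ? ?]]]]]; [left|right; exists F, x, B; split; auto].
Qed.

Definition admissible T : Prop :=
  [/\ forall B, T B -> sentence B, forall B, T B -> in_lang (witness_lang T) B &
      ~ derivable T E].

(** Admissibility passes to unions of chains: [witness_lang] is monotone, and a deduction of [E]
    uses finitely many hypotheses. *)
Lemma admissible_maximal : exists T, [/\ T0 `<=` T, admissible T &
  forall T', T `<=` T' -> admissible T' -> T' `<=` T].
Proof.
(* Zorn's lemma is applied to the sets [X] added to [T0], so that the empty union corresponds to
   [T0] itself, which is admissible. *)
have [|X [aX maxX]] := @Zorn_bigcup (form L) [set X | admissible (T0 `|` X)].
  move=> Z Zadm Ztot.
  have sub X : Z X -> T0 `|` X `<=` T0 `|` \bigcup_(Y in Z) Y.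
    by move=> ZX; apply: setUS => B XB; exists X.
  split.
  - by move=> B [/T0_sentence //|[X /Zadm[sX _ _] XB]]; apply: sX; right.
  - move=> B [T0B|[X ZX XB]] c cB; first by left; exact: T0_in_lang T0B _ cB.
    have [_ oX _] := Zadm _ ZX.
    by apply: witness_langS (sub _ ZX) _ _; apply: oX cB; right.
  - move=> [H HZ dE]; have [HT0|[X ZX HX]] :=
      finite_sub_bigcup (ded_finite dE) Ztot HZ; first by apply: T0E; exists H.
    by have [_ _] := Zadm _ ZX; apply; exists H.
exists (T0 `|` X); split; [exact: subsetUl | exact: aX |].
move=> T' sT' aT' B T'B; apply: contrapT => XB; apply: (maxX T').
  split; first by move=> C XC; apply: sT'; right.
  by move=> sX; apply: XB; right; exact: sX.
rewrite /mkset (_ : T0 `|` T' = T') //; apply/setUidPr => C T0C.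
by apply: sT'; left.
Qed.

(** Each property follows from maximality: if it failed, the theory could be enlarged, or the rules
    would derive [E]. *)
Theorem lindenbaum : exists T, let D := witness_lang T in
  [/\ T0 `<=` T, theory T D, saturated T D & ~ T E].
Proof.
have [T [T0T [sT oT TE] maxT]] := admissible_maximal.
have nE A : T A -> derivable T A by move=> TA; apply: der_hyp => //; exact: sT.
(* Maximality as a criterion for membership. *)
have add B : sentence B -> in_lang (witness_lang T) B ->
    ~ derivable (B |` T) E -> T B.
  move=> sB oB BE; apply: (maxT (B |` T)); [by right| |by left].
  split=> //; first by move=> C [->|/sT].
  have mono : witness_lang T `<=` witness_lang (B |` T).
    by apply: witness_langS; right.
  by move=> C [->|/oT oC] c cC; apply: mono; [exact: oB | exact: oC].
have closed B : sentence B -> in_lang (witness_lang T) B -> derivable T B -> T B.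
  by move=> sB oB dB; apply: add => // BE; apply: TE; exact: der_cut dB BE.
have notE : ~ T E by move=> /nE.
have or A B : T (fOr A B) -> T A \/ T B.
  move=> TAB; have [sA sB] := (sentence_and A B).1 (sT _ TAB).
  have oAB := oT _ TAB.
  (* Were both disjuncts missing, each of them would yield [E] when added, and so would the
     disjunction. *)
  apply: contrapT => /not_orP[nA nB]; apply: TE; apply: (der_orE (nE _ TAB)).
    by apply: contrapT => AE; apply: nA; apply: add => // c cA; apply: oAB; left.
  by apply: contrapT => BE; apply: nB; apply: add => // c cB; apply: oAB; right.
exists T => D; split=> //; split => //.
- move=> A B TAB; have [sA sB] := (sentence_and A B).1 (sT _ TAB).
  have oAB := oT _ TAB.
  apply: contrapT => /not_orP[nA nB]; apply: TE; apply: (der_nandE (nE _ TAB)).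
    by apply: contrapT => AE; apply: nA; apply: add => // c cA; apply: oAB; left.
  by apply: contrapT => BE; apply: nB; apply: add => // c cB; apply: oAB; right.
- move=> F x B FB TF.
  (* If [wit F] is already in the language, injectivity of [wit] shows that it got there as the
     witness of [F] itself. *)
  have [wF|wF] := pselect (witness_lang T (wit F)).
    case: wF => [/wit_fresh //|[F' [x' [B' [/wit_inj <-]]]]].
    by rewrite FB => -[<- <-] _ TD TB; exists (wit F).
  have nc A : T A -> ~ occurs (wit F) A by move=> /oT oA /oA.
  (* Otherwise [wit F] is fresh, so adding it with its instance is conservative over [E] by
     [der_matrixE], and maximality puts both sentences into [T]. *)
  set T' := subst x (wit F) B |` (fDef (Cst (wit F)) |` T).
  have TT' : T `<=` T' by move=> A TA; right; right.
  have T'wF : witness_lang T' (wit F).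
    by right; exists F, x, B; split => //; [exact: TT' | right; left | left].
  have sB : sentence (subst x (wit F) B) := matrix_sentence _ FB (sT _ TF).
  suff T'T : T' `<=` T.
    by exists (wit F); split; apply: T'T; [right; left|left].
  apply: maxT => //; split.
  - by move=> C [->|[->|/sT]].
  - have mono := witness_langS TT'.
    move=> C [->|[->|TC]] c /=; last by move=> /(oT _ TC)/mono.
      move=> /occurs_subst[-> //|cB].
      by apply: mono; apply: oT TF _ _; apply/(occurs_matrix c FB).
    by move=> [<-].
  - move=> dE; apply: TE; apply: (der_matrixE FB (nE _ TF) dE _ _ nc).
      by move=> /(occurs_matrix _ FB); exact: nc.
    by move=> /E_in_lang/wit_fresh.
- move=> c Dc; apply: or; apply: closed.
  + by move=> x.
  + by move=> d /= [|] [<-].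
  + exact: der_PEM.
- move=> c /nE d1 /nE d2; apply: TE; apply: der2 d1 d2 => H1 H2.
  exact: ded_PEX.
Qed.

End Extend.
End Lindenbaum.

(** * Identity in theories *)

Section Theory.
Context {L : language} {T : set (form L)} {D : set (const L)}.
Hypothesis thT : theory T D.
Implicit Types (A B F : form L) (a b c : const L) (p : predE L).

Lemma theory_der B : T B -> derivable T B.
Proof. by move=> TB; apply: der_hyp => //; exact: (theory_sentence thT). Qed.

Lemma theory_mem B : in_lang D B -> derivable T B -> T B.
Proof. by move=> DB dB; apply: (theory_closed thT) => //; exact: der_sentence dB. Qed.

Lemma theory_def_lang c : T (fDef (Cst c)) -> D c.
Proof. by move=> /(theory_in_lang thT); apply. Qed.

Definition atom p (us : (arityE p).-tuple (const L)) : form L :=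
  fPred (map_tuple (@Cst L) us).

(** Treats atoms and negated atoms at once, as the replacement rule [ded_eqE] does. *)
Definition signed (s : bool) A : form L := if s then A else fNeg A.

Lemma signed_in_lang s A : in_lang D (signed s A) <-> in_lang D A.
Proof. by case: s. Qed.

Lemma atom_in_lang p (us : (arityE p).-tuple (const L)) :
  (forall i, D (tnth us i)) -> in_lang D (atom us).
Proof. by move=> Dus c [i]; rewrite tnth_map => -[<-]. Qed.

Lemma theory_atom_def s p (us : (arityE p).-tuple (const L)) i :
  T (signed s (atom us)) -> T (fDef (Cst (tnth us i))).
Proof.
move=> Tus; rewrite -(tnth_map (@Cst L)); apply: theory_mem.
  move=> c /= ci; have /signed_in_lang := theory_in_lang thT Tus.
  by apply; exists i.
by case: s Tus => /theory_der; [exact: der_def | exact: der_ndef].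
Qed.

Lemma theory_atom_lang s p (us : (arityE p).-tuple (const L)) i :
  T (signed s (atom us)) -> D (tnth us i).
Proof. by move=> /(theory_atom_def i)/theory_def_lang. Qed.

Lemma fEq_atom a b : fEq (Cst a) (Cst b) = @atom None [tuple a; b].
Proof.
congr (@fPred L None _); apply: eq_from_tnth => i.
by rewrite tnth_map !(tnth_nth (Cst a)) (tnth_nth a); case: i => [[|[]]].
Qed.

Lemma theory_eq_def a b :
  T (fEq (Cst a) (Cst b)) -> T (fDef (Cst a)) /\ T (fDef (Cst b)).
Proof.
rewrite fEq_atom => h; split.
  exact: (@theory_atom_def true None _ (Ordinal (isT : 0 < 2)) h).
exact: (@theory_atom_def true None _ (Ordinal (isT : 1 < 2)) h).
Qed.

Lemma theory_neq_def a b :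
  T (fNeg (fEq (Cst a) (Cst b))) -> T (fDef (Cst a)) /\ T (fDef (Cst b)).
Proof.
rewrite fEq_atom => h; split.
  exact: (@theory_atom_def false None _ (Ordinal (isT : 0 < 2)) h).
exact: (@theory_atom_def false None _ (Ordinal (isT : 1 < 2)) h).
Qed.

Lemma theory_eqI a : T (fDef (Cst a)) -> T (fEq (Cst a) (Cst a)).
Proof.
move=> Ta; apply: theory_mem.
  rewrite fEq_atom; apply: atom_in_lang => i.
  by rewrite (tnth_nth a); case: i => [[|[]]] //= _; exact: theory_def_lang.
by apply: der1 (theory_der Ta) => H; exact: ded_eqI.
Qed.

(* The template A(x) with [x] at the positions selected by [S]. *)
Definition template p (S : pred 'I_(arityE p)) (us : (arityE p).-tuple (const L)) :
  form L := fPred [tuple if S i then Var 0 else Cst (tnth us i) | i < arityE p].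

Lemma subst_template p S (us : (arityE p).-tuple (const L)) c :
  subst 0 c (template S us) =
  atom [tuple if S i then c else tnth us i | i < arityE p].
Proof.
congr (fPred _); apply: eq_from_tnth => i; rewrite !tnth_map !tnth_ord_tuple.
by case: (S i).
Qed.

Lemma theory_eqE s p (S : pred 'I_(arityE p)) (us : (arityE p).-tuple (const L)) a b :
  T (fEq (Cst a) (Cst b)) -> T (signed s (subst 0 a (template S us))) ->
  T (signed s (subst 0 b (template S us))).
Proof.
move=> Tab Ta; apply: theory_mem.
  apply/signed_in_lang => c /occurs_subst[->|cS].
    by apply: theory_def_lang; case: (theory_eq_def Tab).
  by have /signed_in_lang := theory_in_lang thT Ta; apply; exact: occurs_substr.
have signed_subst c : signed s (subst 0 c (template S us)) =
    subst 0 c (signed s (template S us)) by case: s {Ta}.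
rewrite signed_subst in Ta *; rewrite signed_subst.
apply: der2 (theory_der Ta) (theory_der Tab) => H1 H2.
by apply: ded_eqE; case: s {Ta signed_subst}.
Qed.

(** [ded_eqE] exchanges one constant for another, so the tuple is changed one position at a time:
    [ws j] has its first [j] entries from [vs]. *)
Lemma theory_congr s p (us vs : (arityE p).-tuple (const L)) :
  (forall i, T (fEq (Cst (tnth us i)) (Cst (tnth vs i)))) ->
  T (signed s (atom us)) -> T (signed s (atom vs)).
Proof.
move=> Tuv Tus.
pose ws j : (arityE p).-tuple (const L) :=
  [tuple if i < j then tnth vs i else tnth us i | i < arityE p].
suff /(_ (arityE p) (leqnn _)) : forall j, j <= arityE p -> T (signed s (atom (ws j))).
  congr (T (signed s (atom _))); apply: eq_from_tnth => i.
  by rewrite tnth_mktuple ltn_ord.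
elim=> [_|j IH jp].
  suff -> : ws 0 = us by [].
  by apply: eq_from_tnth => i; rewrite tnth_mktuple.
pose k := Ordinal jp; have /(_ (ltnW jp)) := IH.
(* Consecutive tuples are the two instances of one template with its variable at position [j]
   only. *)
have ws_subst l c : (l = j /\ c = tnth us k) \/ (l = j.+1 /\ c = tnth vs k) ->
    atom (ws l) = subst 0 c (template (pred1 k) (ws j)).
  move=> lc; rewrite subst_template; congr atom; apply: eq_from_tnth => i.
  rewrite !tnth_mktuple /=; case: (eqVneq i k) => [->|ik].
    by case: lc => -[-> ->] /=; rewrite ?ltnn ?ltnSn.
  case: lc => -[-> _] //; rewrite ltnS leq_eqVlt.
  by rewrite -[(i : nat) == j]/(i == k) (negbTE ik).
rewrite (ws_subst j (tnth us k)); last by left.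
rewrite (ws_subst j.+1 (tnth vs k)); last by right.
exact: theory_eqE.
Qed.

(** Congruence of the identity predicate itself, which turns a = a into b = a. *)
Lemma theory_eq_sym a b : T (fEq (Cst a) (Cst b)) -> T (fEq (Cst b) (Cst a)).
Proof.
move=> Tab; have [Ta _] := theory_eq_def Tab.
have Taa := theory_eqI Ta; move: (Taa); rewrite !fEq_atom in Taa *.
apply: (theory_congr (s := true)) => i; rewrite !(tnth_nth a).
by case: i => [[|[]]] //= _; exact: theory_eqI.
Qed.

Lemma theory_eq_trans a b c : T (fEq (Cst a) (Cst b)) ->
  T (fEq (Cst b) (Cst c)) -> T (fEq (Cst a) (Cst c)).
Proof.
move=> Tab Tbc; have [Ta _] := theory_eq_def Tab; move: Tab.
rewrite !fEq_atom; apply: (theory_congr (s := true)) => i; rewrite !(tnth_nth a).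
by case: i => [[|[]]] //= _; exact: theory_eqI.
Qed.

Lemma theory_diff p (us vs : (arityE p).-tuple (const L)) a b :
  (exists i, tnth us i = a /\ tnth vs i = b) ->
  (forall i, tnth us i = tnth vs i \/ (tnth us i = a /\ tnth vs i = b)) ->
  T (atom us) -> T (fNeg (atom vs)) -> T (fNeg (fEq (Cst a) (Cst b))).
Proof.
move=> [k [uk vk]] uv Tus Tvs.
(* Positions are selected by their values and not by a difference of the entries, so that the
   variable occurs in the template even when [a] and [b] coincide. *)
pose S : pred 'I_(arityE p) := fun i => `[< tnth us i = a /\ tnth vs i = b >].
have usE : atom us = subst 0 a (template S us).
  rewrite subst_template; congr atom; apply: eq_from_tnth => i.
  by rewrite tnth_mktuple /S; case: asboolP => // -[].
have vsE : atom vs = subst 0 b (template S us).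
  rewrite subst_template; congr atom; apply: eq_from_tnth => i.
  by rewrite tnth_mktuple /S; case: asboolP => [[]//|]; case: (uv i).
apply: theory_mem.
  rewrite fEq_atom => c [i]; rewrite tnth_map => -[<-]; rewrite (tnth_nth a).
  case: i => [[|[]]] //= _.
    by rewrite -uk; exact: (@theory_atom_lang true _ _ k Tus).
  by rewrite -vk; exact: (@theory_atom_lang false _ _ k Tvs).
rewrite usE in Tus; rewrite vsE in Tvs.
apply: der2 (theory_der Tus) (theory_der Tvs) => H1 H2; apply: ded_neqI => //.
apply/has_tnthP; exists k; rewrite tnth_mktuple /S.
by case: asboolP => // -[].
Qed.

(** The atoms b = b and a = b differ in their first place, with [b] replaced by [a], so
    [theory_diff] applies to them. *)
Lemma theory_neq_sym a b :
  T (fNeg (fEq (Cst a) (Cst b))) -> T (fNeg (fEq (Cst b) (Cst a))).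
Proof.
move=> Tab; have [_ Tb] := theory_neq_def Tab.
have := theory_eqI Tb; move: Tab; rewrite !fEq_atom => Tab Tbb; rewrite -fEq_atom.
apply: (@theory_diff None [tuple b; b] [tuple a; b]) => //.
  by exists (Ordinal (isT : 0 < 2)); rewrite !(tnth_nth a).
by move=> i; rewrite !(tnth_nth a); case: i => [[|[]]] //= _; auto.
Qed.

End Theory.

(** * The canonical model *)

Section Canonical.
Context {P : Type} {ar : P -> nat} {C : Type} {iC : infinite_set [set: C]}.

(* Codes of formulas, used as additional constants: there are enough of them
   whatever the cardinality of the language. *)
Definition code : Type := GenTree.tree (C + P).

Notation L := (@lang_on P ar C iC).

Lemma infinite_big : infinite_set [set: C + code].
Proof. exact: infinite_suml. Qed.

Notation BL := (@lang_on P ar (C + code) infinite_big).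

(** Tag 0 marks a code serving as a new constant; variables take the tags from 1 on. *)
Definition code_term (t : term BL) : code :=
  match t with
  | Var x => GenTree.Node x.+1 [::]
  | Cst c => match (c : C + code) with
    | inl c' => GenTree.Leaf (inl c')
    | inr n => GenTree.Node 0 [:: n]
    end
  end.

Fixpoint code_form (A : form BL) : code :=
  match A with
  | fPred (Some p) ts =>
      GenTree.Node 0 (GenTree.Leaf (inr p) :: map code_term ts)
  | fPred None ts => GenTree.Node 1 (map code_term ts)
  | fDef t => GenTree.Node 2 [:: code_term t]
  | fNeg B => GenTree.Node 3 [:: code_form B]
  | fAnd A B => GenTree.Node 4 [:: code_form A; code_form B]
  | fOr A B => GenTree.Node 5 [:: code_form A; code_form B]
  | fAll x B => GenTree.Node 6 [:: GenTree.Node x [::]; code_form B]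
  | fEx x B => GenTree.Node 7 [:: GenTree.Node x [::]; code_form B]
  end.

Lemma code_term_inj : injective code_term.
Proof.
by move=> [x|[c|n]] [y|[d|m]] //= [->].
Qed.

Lemma code_form_inj : injective code_form.
Proof.
elim=> [p ts|t|A IH|A IHA B IHB|A IHA B IHB|x A IH|x A IH]
  [q us|u|A'|A' B'|A' B'|y A'|y A'] /=;
  try by [case: p ts => [?|] ? | case: q us => [?|] ? | ].
- case: p ts => [p|] ts; case: q us => [q|] us //= [].
    by move=> pq; subst q; move=> /(inj_map code_term_inj)/val_inj ->.
  by move=> /(inj_map code_term_inj)/val_inj ->.
- by case=> /code_term_inj ->.
- by case=> /IH ->.
- by case=> /IHA -> /IHB ->.
- by case=> /IHA -> /IHB ->.
- by case=> -> /IH ->.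
- by case=> -> /IH ->.
Qed.

(** The tag [k] separates the constants introduced by successive extensions. *)
Definition witness (k : nat) (F : form BL) : const BL :=
  inr (GenTree.Node k [:: code_form F]).

Lemma witness_inj k k' F F' : witness k F = witness k' F' -> k = k' /\ F = F'.
Proof. by case=> -> /code_form_inj. Qed.

Record stage : Type := Stage {
  truths : set (form BL);
  names : set (const BL);
  stage_theory : theory truths names }.

(* The stages at which truth is membership; the remaining ones are only there
   to make every individual exist somewhere. *)
Definition prime_stage (w : stage) : Prop :=
  [/\ saturated (truths w) (names w), forall c, names w (inl c) &
      exists k, forall j F, k <= j -> ~ names w (witness j F)].

(** The last clause keeps everything above a prime stage prime, so that the induction for truth
    never leaves the prime stages. *)
Definition accessible (w w' : stage) : Prop :=
  [/\ truths w `<=` truths w', names w `<=` names w' & prime_stage w -> prime_stage w'].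

Lemma theory_total : theory (@sentence BL) setT.
Proof. by []. Qed.

(** The inconsistent theory: all constants are defined in it, which gives every individual a stage
    where it exists. *)
Definition total_stage : stage := Stage theory_total.

Definition exists_at (w : stage) : set (const BL) :=
  [set a | truths w (fDef (Cst a))].

Definition value_at (w : stage) (c : C) : option (const BL) :=
  if `[< exists_at w (inl c) >] then Some (inl c) else None.

Definition positive_at (w : stage) (p : P) (us : (ar p).-tuple (const BL)) : Prop :=
  truths w (@atom BL (Some p) us).

Definition negative_at (w : stage) (p : P) (us : (ar p).-tuple (const BL)) : Prop :=
  truths w (fNeg (@atom BL (Some p) us)).

Definition equal_at (w : stage) (a b : const BL) : Prop :=
  truths w (fEq (Cst a) (Cst b)).

Definition unequal_at (w : stage) (a b : const BL) : Prop :=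
  truths w (fNeg (fEq (Cst a) (Cst b))).

Lemma value_atE w c a : value_at w c = Some a <-> a = inl c /\ exists_at w a.
Proof.
rewrite /value_at; case: asboolP => h; split=> //.
- by case=> <-.
- by case=> ->.
- by case=> -> /h.
Qed.

Lemma extension_positive (w : stage) (p : predE BL)
    (us : (arityE p).-tuple (const BL)) :
  @extension BL stage (const BL) equal_at positive_at w p us <-> truths w (atom us).
Proof.
case: p us => [p|] us //=; rewrite /equal_at fEq_atom.
suff -> : [tuple tnth us ord0; tnth us ord_max] = us by [].
apply: eq_from_tnth => i; rewrite (tnth_nth (tnth us ord0)).
by case: i => [[|[]]] //= h; congr tnth; exact: val_inj.
Qed.

Lemma extension_negative (w : stage) (p : predE BL)
    (us : (arityE p).-tuple (const BL)) :
  @extension BL stage (const BL) unequal_at negative_at w p us <->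
  truths w (fNeg (atom us)).
Proof.
case: p us => [p|] us //=; rewrite /unequal_at fEq_atom.
suff -> : [tuple tnth us ord0; tnth us ord_max] = us by [].
apply: eq_from_tnth => i; rewrite (tnth_nth (tnth us ord0)).
by case: i => [[|[]]] //= h; congr tnth; exact: val_inj.
Qed.

(** Individuals are the constants themselves and not their equivalence classes, as [ipos] only has
    to be a congruence. The definition is transparent so that its components unfold later. *)
Definition canonical_model : model L.
Proof.
refine (@Model L stage accessible (const BL) exists_at value_at positive_at
  negative_at equal_at unequal_at
  (inhabits total_stage) _ _ _ _ _ _ _ _ _ _ _ _ _ _ _ _ _ _ _ _).
- by move=> w; split.
- move=> w1 w2 w3 [t12 n12 p12] [t23 n23 p23].
  by split; [exact: subset_trans t23 | exact: subset_trans n23 | auto].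
- by move=> a; exists total_stage => x.
- by move=> w w' [tt _ _] a; exact: tt.
- by move=> w c a /value_atE[].
- by move=> w w' c a [tt _ _] /value_atE[ac wa]; apply/value_atE; split=> //; exact: tt.
- move=> w p us h k; 
  exact: (@theory_atom_def _ _ _ (stage_theory w) true (Some p) us k).
- move=> w p us h k; 
  exact: (@theory_atom_def _ _ _ (stage_theory w) false (Some p) us k).
- by move=> w w' p us [tt _ _]; exact: tt.
- by move=> w w' p us [tt _ _]; exact: tt.
- by move=> w a b; exact: (theory_eq_def (stage_theory w)).
- by move=> w a b; exact: (theory_neq_def (stage_theory w)).
- by move=> w a; exact: (theory_eqI (stage_theory w)).
- by move=> w a b; exact: (theory_eq_sym (stage_theory w)).
- by move=> w a b c; exact: (theory_eq_trans (stage_theory w)).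
- by move=> w p us vs; exact: (@theory_congr _ _ _ (stage_theory w) true (Some p)).
- by move=> w p us vs; exact: (@theory_congr _ _ _ (stage_theory w) false (Some p)).
- move=> w p us vs a b ab uv /extension_positive pos /extension_negative neg.
  have nab := theory_diff (stage_theory w) ab uv pos neg.
  by split=> //; exact: (theory_neq_sym (stage_theory w)).
- by move=> w w' a b [tt _ _]; exact: tt.
- by move=> w w' a b [tt _ _]; exact: tt.
Defined.

End Canonical.

(** * Truth at a prime stage *)

Section Holds.
Context {L : language} {K : model L}.
Implicit Types (A B F : form (diagram K)) (w : world K).

(** Inversion of [holds] by recursion on the shape of the sentence. The quantified shapes are left
    trivial here and inverted by [holds_matrix] and [holds_universal]. *)
Definition holds_clause w A : Prop :=
  match A with
  | fPred p ts => exists2 us : (arityE p).-tuple (ind K),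
      denotes_tuple w ts us & extension (@ipos L K) (@ppos L K) w us
  | fDef t => exists c a, t = Cst c /\ denotes w c a
  | fAnd A B => holds w A /\ holds w B
  | fOr A B => holds w A \/ holds w B
  | fNeg (fPred p ts) => exists2 us : (arityE p).-tuple (ind K),
      denotes_tuple w ts us & extension (@ineg L K) (@pneg L K) w us
  | fNeg (fDef t) => exists2 c, t = Cst c & forall a, ~ denotes w c a
  | fNeg (fNeg A) => holds w A
  | fNeg (fAnd A B) => holds w (fNeg A) \/ holds w (fNeg B)
  | fNeg (fOr A B) => holds w (fNeg A) /\ holds w (fNeg B)
  | fAll _ _ | fEx _ _ | fNeg (fAll _ _) | fNeg (fEx _ _) => True
  end.

Lemma holds_inv w A : holds w A -> holds_clause w A.
Proof.
case=> {w A} //=; try by [left|right|split].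
- by move=> w c a ca; exists c, a.
- by move=> w c ca; exists c.
- by move=> w p ts us; exists us.
- by move=> w p ts us; exists us.
Qed.

Lemma holds_matrix w F x B : matrix_of F = Some (x, B) ->
  holds w F <-> exists2 a, dom w a & holds w (subst x (bar a) B).
Proof.
move=> FB; split; last first.
  move=> [a]; case: F FB => // [[]|] //= y B' [<- <-];
    [exact: holds_nall | exact: holds_ex].
move=> h; case: h FB => // {}w y B' a wa h [<- <-]; by exists a.
Qed.

Lemma holds_universal w F x B : universal_of F = Some (x, B) ->
  holds w F <-> forall w' a, wle w w' -> dom w' a -> holds w' (subst x (bar a) B).
Proof.
move=> FB; split; last first.
  case: F FB => // [[]|] //= y B' [<- <-];
    [exact: holds_nex | exact: holds_all].
by move=> h; case: h FB => // {}w y B' h [<- <-].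
Qed.

End Holds.

(** * Collapse of the diagram language and the truth lemma *)

Section Truth.
Context {P : Type} {ar : P -> nat} {C : Type} {iC : infinite_set [set: C]}.
Notation L := (@lang_on P ar C iC).
Notation BL := (@lang_on P ar (C + @code P C) (@infinite_big P C iC)).
Notation K := (@canonical_model P ar C iC).
Notation DL := (diagram K).

(** As individuals are constants, the name of an individual collapses to that individual. An old
    constant is thereby identified with the name of its denotation, so the map is not injective. *)
Definition collapse_const (c : const DL) : const BL :=
  match (c : C + const BL) with inl c' => inl c' | inr a => a end.

Definition collapse : form DL -> form BL :=
  @rename P ar (C + const BL) _ (infinite_suml iC) _ collapse_const.

Lemma collapse_subst x (c : const DL) A :
  collapse (subst x c A) = subst x (collapse_const c) (collapse A).
Proof. exact: rename_subst. Qed.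

Lemma collapse_diagram (A : form L) :
  collapse (diagram_form K A) = @rename P ar C _ iC (@infinite_big P C iC) inl A.
Proof.
have collapse_term (t : term L) :
    @rename_term P ar (C + const BL) _ (infinite_suml iC) (@infinite_big P C iC)
      collapse_const (diagram_term K t) =
    @rename_term P ar C _ iC (@infinite_big P C iC) inl t by case: t.
rewrite /collapse; elim: A => //=.
- move=> p ts; congr (@fPred BL p _); apply: eq_from_tnth => i.
  by rewrite !tnth_map; exact: collapse_term.
- by move=> t; congr fDef; exact: collapse_term.
- by move=> A ->.
- by move=> A -> B ->.
- by move=> A -> B ->.
- by move=> x A ->.
- by move=> x A ->.
Qed.

Lemma denotes_canonical (w : world K) (c : const DL) a :
  denotes w c a <-> a = collapse_const c /\ exists_at w a.
Proof.
case: c => [c|b] /=; first exact: value_atE.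
by split=> [[->]|[->]].
Qed.

(** The weight two lets negations move inwards: the negated parts of a negated compound together
    still have a smaller size than the compound. *)
Fixpoint fsize (L : language) (A : form L) : nat :=
  match A with
  | fPred _ _ | fDef _ => 0
  | fNeg B => (fsize B).+1
  | fAnd B C | fOr B C => (fsize B + fsize C).+2
  | fAll x B | fEx x B => (fsize B).+2
  end.

Lemma fsize_subst (L' : language) x c (A : form L') : fsize (subst x c A) = fsize A.
Proof.
elim: A => //=.
- by move=> A ->.
- by move=> A -> B ->.
- by move=> A -> B ->.
- by move=> y A IH; case: ifP => //= _; rewrite IH.
- by move=> y A IH; case: ifP => //= _; rewrite IH.
Qed.

(** With a fresh [c] assumed defined, the instance at [c] is not derivable from [w], since otherwise
    [F] would be; [lindenbaum] preserves this underivability. *)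
Lemma extend_stage (w : @stage P ar C iC) F x B :
  prime_stage w -> universal_of F = Some (x, B) ->
  sentence F -> in_lang (names w) F -> ~ truths w F ->
  exists w' c, [/\ accessible w w', exists_at w' c, prime_stage w' &
                   ~ truths w' (subst x c B)].
Proof.
move=> pw FB sF oF wF; have [satw basew [k freshk]] := pw.
pose c : const BL := witness k F.
have wc : ~ names w c by exact: freshk.
have cB : ~ occurs c B by move=> /(occurs_universal c FB)/oF.
have cw C' : truths w C' -> ~ occurs c C'.
  by move=> /(theory_in_lang (stage_theory w)) oC /oC.
(* [c] has tag [k], so the new witnesses take tag [k.+1], which neither [c] nor any name of [w]
   carries. *)
have wit_fresh G : ~ (c |` names w) (witness k.+1 G).
  move=> [/witness_inj[/esym/n_Sn]//|]; exact: freshk.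
have sB : sentence (subst x c B) := universal_sentence _ FB sF.
have [||||||T] := @lindenbaum BL (fDef (Cst c) |` truths w) (c |` names w)
    (subst x c B) (witness k.+1) _ wit_fresh.
- by move=> G G' /witness_inj[].
- by move=> G [->|/(theory_sentence (stage_theory w))].
- move=> G [->|/(theory_in_lang (stage_theory w)) oG] d.
    by move=> /= [<-]; left.
  by move=> /oG; right.
- by [].
- apply: in_lang_subst; first by left.
  by move=> d /(occurs_universal d FB)/oF; right.
- move=> dB; apply: wF; apply: (theory_mem (stage_theory w)) => //.
  exact: der_universalI FB dB cB cw.
move=> [T0T thT satT TE]; exists (Stage thT), c.
have sub : names w `<=` witness_lang (c |` names w) (witness k.+1) T.
  by move=> d wd; left; right.
have pT : prime_stage (Stage thT).
  split => //=; first by move=> d; apply: sub.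
  (* The new stage adds tags [k] and [k.+1] only, so [k.+2] bounds its tags. *)
  exists k.+2 => j G kj [[/witness_inj[jk _]|]|[G' [y [B' [/witness_inj[jk _]]]]]].
  - by move: kj; rewrite jk ltnNge leqnSn.
  - by apply: freshk; apply: leq_trans kj; rewrite leqW.
  - by move: kj; rewrite jk ltnn.
split => //; last by apply: T0T; left.
by split => // G wG; apply: T0T; right.
Qed.

Lemma fsize_matrix (L' : language) (F B : form L') x :
  matrix_of F = Some (x, B) -> fsize B < fsize F.
Proof. by case: F => // [[]|] //= ? ? [_ <-] //=. Qed.

Lemma fsize_universal (L' : language) (F B : form L') x :
  universal_of F = Some (x, B) -> fsize B < fsize F.
Proof. by case: F => // [[]|] //= ? ? [_ <-] //=. Qed.

Lemma matrix_collapse F x B : @matrix_of DL F = Some (x, B) ->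
  matrix_of (collapse F) = Some (x, collapse B).
Proof. by case: F => // [[]|] //= ? ? [<- <-]. Qed.

Lemma universal_collapse F x B : @universal_of DL F = Some (x, B) ->
  universal_of (collapse F) = Some (x, collapse B).
Proof. by case: F => // [[]|] //= ? ? [<- <-]. Qed.

(** All arguments of an atomic sentence are constants, and each can denote only its collapse, so one
    tuple [us] serves at every stage. *)
Lemma collapse_atom (p : predE DL) (ts : (arityE p).-tuple (term DL)) :
  sentence (fPred ts) -> exists us : (arityE p).-tuple (const BL),
    collapse (fPred ts) = @atom BL p us /\
    forall (w : world K) (vs : (arityE p).-tuple (const BL)),
      denotes_tuple w ts vs <-> vs = us /\ forall i, exists_at w (tnth us i).
Proof.
move=> /sentence_pred/choice[f tsf].
exists [tuple collapse_const (f i) | i < arityE p]; split.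
  congr (@fPred BL p _); apply: eq_from_tnth => i.
  by rewrite !tnth_map tnth_ord_tuple tsf.
move=> w vs; split=> [wvs|[-> wus] i].
  have vsf i : tnth vs i = collapse_const (f i) /\ exists_at w (tnth vs i).
    by have [c] := wvs i; rewrite tsf => -[<-] /denotes_canonical.
  have vsE : vs = [tuple collapse_const (f i) | i < arityE p].
    by apply: eq_from_tnth => i; rewrite tnth_mktuple; case: (vsf i).
  by split=> // i; rewrite -vsE; case: (vsf i).
by exists (f i) => //; apply/denotes_canonical; rewrite {1}tnth_mktuple.
Qed.

(** Induction on [fsize], for all prime stages at once. Saturation gives the disjunctive,
    existential and definedness cases, [extend_stage] the universal ones, and closure under
    derivability the others. *)
Lemma truth (w : world K) (A : form DL) : prime_stage w -> sentence A ->
  in_lang (names w) (collapse A) -> holds w A <-> truths w (collapse A).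
Proof.
have [n] := ubnP (fsize A); elim: n => // n IH in w A *.
rewrite ltnS => An pw sA oA; have th := stage_theory w.
have mem B : in_lang (names w) B -> derivable (truths w) B -> truths w B.
  exact: theory_mem.
have der B : truths w B -> derivable (truths w) B by exact: (theory_der th).
have [satw _ _] := pw.
case FA: (universal_of A) => [[x B]|].
  have FA' := universal_collapse FA.
  have IHB (w' : world K) a : wle w w' -> dom w' a ->
      holds w' (subst x (bar a) B) <-> truths w' (subst x a (collapse B)).
    move=> [_ nn pp] wa; rewrite -[subst x a _](collapse_subst x (bar a)).
    apply: IH; rewrite ?fsize_subst; [| exact: pp | exact: (universal_sentence _ FA sA) |].
      exact: leq_trans (fsize_universal FA) An.
    rewrite collapse_subst; apply: in_lang_subst.
      exact: theory_def_lang (stage_theory w') _ wa.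
    by move=> d /(occurs_universal d FA')/oA/nn.
  rewrite (holds_universal w FA); split=> [h|TA w' a ww' wa].
    (* A universal sentence missing from the theory has a false instance at some later prime
       stage. *)
    apply: contrapT => TA.
    have sA' : sentence (collapse A) by apply/sentence_rename.
    have [w' [c [ww' wc pw' nB]]] := extend_stage pw FA' sA' oA TA.
    by apply: nB; apply/IHB => //; exact: h.
  have [tt nn _] := ww'.
  apply/IHB => //; apply: (theory_mem (stage_theory w')).
    apply: in_lang_subst; first exact: theory_def_lang (stage_theory w') _ wa.
    by move=> d /(occurs_universal d FA')/oA/nn.
  apply: der_universalE FA' (theory_der (stage_theory w') (tt _ TA)) _.
  exact: theory_der (stage_theory w') _ wa.
case MA: (matrix_of A) => [[x B]|].
  have MA' := matrix_collapse MA.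
  have oB a : dom w a -> in_lang (names w) (subst x a (collapse B)).
    move=> wa; apply: in_lang_subst; first exact: theory_def_lang th _ wa.
    by move=> d /(occurs_matrix d MA')/oA.
  have IHB a : dom w a ->
      holds w (subst x (bar a) B) <-> truths w (subst x a (collapse B)).
    move=> wa; rewrite -[subst x a _](collapse_subst x (bar a)).
    apply: IH; rewrite ?fsize_subst //; [| exact: (matrix_sentence _ MA sA) |].
      exact: leq_trans (fsize_matrix MA) An.
    by rewrite collapse_subst; exact: oB.
  rewrite (holds_matrix w MA); split=> [[a wa /(IHB a wa)TB]|TA].
    by apply: mem => //; exact: der_matrixI MA' (der _ TB) (der _ wa).
  have [c [wc TB]] := saturated_witness satw MA' TA.
  by exists c => //; apply/IHB.
have IHn B : fsize B < n -> sentence B -> in_lang (names w) (collapse B) ->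
    holds w B <-> truths w (collapse B).
  by move=> Bn sB oB; exact: IH.
(* Serves the binary connectives and, with negated components, the negated ones, whose sentence and
   language conditions agree by conversion. *)
have pair A' B' : sentence (fAnd A' B') -> fsize A' + fsize B' < n ->
    (forall c, occurs c (collapse A') \/ occurs c (collapse B') -> names w c) ->
    [/\ holds w A' <-> truths w (collapse A'),
        holds w B' <-> truths w (collapse B'),
        in_lang (names w) (collapse A'), in_lang (names w) (collapse B') &
        sentence (collapse A') /\ sentence (collapse B')].
  move=> /sentence_and[sA' sB'] An' oAB.
  have oA' : in_lang (names w) (collapse A') by move=> c cA; apply: oAB; left.
  have oB' : in_lang (names w) (collapse B') by move=> c cB; apply: oAB; right.
  split=> //; last by split; apply/sentence_rename.
    by apply: IHn => //; apply: leq_ltn_trans An'; exact: leq_addr.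
  by apply: IHn => //; apply: leq_ltn_trans An'; exact: leq_addl.
have neg_size a b : (a + b).+3 <= n -> a.+1 + b.+1 < n by rewrite addSn addnS.
case: A An sA oA FA MA => // [p ts|t|A|A B|A B] An sA oA FA MA.
- have [us [tsE usE]] := collapse_atom sA; rewrite tsE; split.
    by move=> /holds_inv[vs /usE[-> _] /extension_positive].
  move=> Tus; apply: (@holds_pred _ _ _ _ _ us); last exact/extension_positive.
  by apply/usE; split => // i; exact: (@theory_atom_def _ _ _ th true).
- have /sentence_def[c tc] := sA; rewrite tc; split.
    by move=> /holds_inv[d [a [[<-] /denotes_canonical[-> ]]]].
  by move=> Tc; apply: holds_def; apply/denotes_canonical; split; first by [].
- case: A An sA oA FA MA => // [p ts|t|A|A B|A B] An sA oA _ _.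
  + have [us [tsE usE]] := collapse_atom (sA : sentence (fPred ts)).
    rewrite (_ : collapse _ = fNeg (collapse (fPred ts))) // tsE; split.
      by move=> /holds_inv[vs /usE[-> _] /extension_negative].
    move=> Tus; apply: (@holds_npred _ _ _ _ _ us); last exact/extension_negative.
    by apply/usE; split => // i; exact: (@theory_atom_def _ _ _ th false).
  + have /sentence_def[c tc] := sA : sentence (fDef t).
    rewrite tc in oA *; split.
      move=> /holds_inv[d [<-]] nd.
      (* Were the definedness statement in the theory, the collapse of [c] would be a denotation of
         [c]. *)
      have [|Td|//] := saturated_def satw (c := collapse_const c); first exact: oA.
      by case: (nd (collapse_const c)); apply/denotes_canonical.
    move=> Tc; apply: holds_ndef => a /denotes_canonical[-> Td].
    exact: saturated_consistent satw _ Td Tc.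
  + have IA := IHn A (ltnW An) sA oA; split.
      move=> /holds_inv/IA TA; apply: mem => //.
      by apply: der1 (der _ TA) => H; exact: ded_DNI.
    move=> TA; apply: holds_nneg; apply/IA; apply: mem => //.
    by apply: der1 (der _ TA) => H; exact: ded_DNE.
  + have [IA IB oA' oB' [sA' sB']] :=
      pair (fNeg A) (fNeg B) sA (neg_size _ _ An) oA.
    split=> [/holds_inv[/IA TA|/IB TB]|TAB].
    * apply: mem => //; apply: der1 (der _ TA) => H; exact: ded_nandIl.
    * apply: mem => //; apply: der1 (der _ TB) => H; exact: ded_nandIr.
    case: (saturated_nand satw TAB) => [/IA|/IB].
      exact: holds_nandl.
    exact: holds_nandr.
  + have [IA IB oA' oB' _] := pair (fNeg A) (fNeg B) sA (neg_size _ _ An) oA.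
    split=> [/holds_inv[/IA TA /IB TB]|TAB].
      apply: mem => //; apply: der2 (der _ TA) (der _ TB) => H1 H2.
      exact: ded_norI.
    apply: holds_nor; [apply/IA | apply/IB]; apply: mem => //;
      apply: der1 (der _ TAB) => H; [exact: ded_norEl | exact: ded_norEr].
- have [IA IB oA' oB' _] := pair A B sA (ltnW An) oA.
  split=> [/holds_inv[/IA TA /IB TB]|TAB].
    apply: mem => //; apply: der2 (der _ TA) (der _ TB) => H1 H2.
    exact: ded_andI.
  apply: holds_and; [apply/IA | apply/IB]; apply: mem => //;
    apply: der1 (der _ TAB) => H; [exact: ded_andEl | exact: ded_andEr].
- have [IA IB oA' oB' [sA' sB']] := pair A B sA (ltnW An) oA.
  split=> [/holds_inv[/IA TA|/IB TB]|TAB].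
  + apply: mem => //; apply: der1 (der _ TA) => H; exact: ded_orIl.
  + apply: mem => //; apply: der1 (der _ TB) => H; exact: ded_orIr.
  by case: (saturated_or satw TAB) => [/IA|/IB]; [exact: holds_orl | exact: holds_orr].
Qed.
End Truth.

(** * Completeness *)

Section Completeness.

(** Induction on a list of the elements of [S]: the value chosen for the head is removed from [X]
    before the tail is placed. *)
Lemma exists_inj_on (T U : Type) (S : set T) (X : set U) :
  finite_set S -> infinite_set X ->
  exists g : T -> U, (forall x, S x -> X (g x)) /\
    forall x y, S x -> S y -> g x = g y -> x = y.
Proof.
move=> /(@finite_seqP {classic T})[s ->] {S}.
elim: s X => [|z s IH] X infX; have [u Xu] := infinite_setN0 infX.
  by exists (fun=> u); split.
have [g [Xg g_inj]] := IH _ (infinite_setD infX (finite_set1 u)).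
exists (fun x => if pselect (x = z) then u else g x); split=> [x|x y] /=.
  case: pselect => // xz; rewrite inE => /predU1P[//|xs].
  by have [] := Xg x xs.
rewrite !inE; case: (pselect (x = z)) (pselect (y = z)) => [xz|xz] [yz|yz] /=.
- by rewrite xz yz.
- by move=> _ /predU1P[//|ys] gy; have [_ []] := Xg _ ys.
- by move=> /predU1P[//|xs] _ gx; have [_ []] := Xg _ xs.
- by move=> /predU1P[//|xs] /predU1P[//|ys]; exact: g_inj.
Qed.

Context {P : Type} {ar : P -> nat} {C : Type} {iC : infinite_set [set: C]}.
Notation L := (@lang_on P ar C iC).

(* Only finitely many of the new constants occur in a deduction, and they can be
   renamed to constants of [C] that do not occur in it. *)
Lemma derivable_conservative (N : Type) (i : infinite_set [set: C + N])
    (G : set (form L)) A :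
  let emb := @rename P ar C (C + N) iC i inl in
  derivable (emb @` G) (emb A) -> derivable G A.
Proof.
move=> emb [H HG dA]; have [S finS dS] := ded_rename (i2 := iC) dA.
have finl : finite_set (inl @^-1` S : set C).
  by apply: finite_preimage finS => x y _ _ [].
have finr : finite_set (inr @^-1` S : set N).
  by apply: finite_preimage finS => x y _ _ [].
(* The values of [g] avoid the old constants in [S], which [f] leaves fixed, so that [f] is
   injective on [S]. *)
have [g [gS g_inj]] := exists_inj_on finr (infinite_setD iC finl).
pose f (c : C + N) : C := match c with inl c => c | inr n => g n end.
have f_inj : @inj_on P ar (C + N) C i iC S f.
  move=> [c|n] [d|m] Sx Sy //= e; first by rewrite e.
  - by have [_] := gS m Sy; rewrite -e.
  - by have [_] := gS n Sx; rewrite e.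
  - by rewrite (g_inj n m).
(* [f] is the identity on old constants and hence undoes the embedding. *)
have fK B : rename (f : const (lang_on i) -> const L) (emb B) = B.
  by rewrite rename_comp rename_id.
have := dS f f_inj; rewrite fK; apply: der_weak => _ [B HB <-].
by have [B' GB' <-] := HG _ HB; rewrite fK.
Qed.

(** By contraposition: if [A] is not derivable from [G], it is not derivable in the larger language
    either, and [lindenbaum] gives a stage of the canonical model where [G] holds and [A] fails. *)
Lemma completeness (G : set (form L)) (A : form L) :
  (forall B, G B -> sentence B) -> sentence A -> entails G A -> derivable G A.
Proof.
move=> sG sA GA; apply: contrapT => nA.
pose emb := @rename P ar C _ iC (@infinite_big P C iC) inl.
pose D : set (const (@lang_on P ar (C + @code P C) (@infinite_big P C iC))) :=
  range inl.
have emb_range B : in_lang D (emb B).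
  by move=> c /occurs_rename[d <- _]; exists d.
have [|||||||T] := @lindenbaum _ (emb @` G) D (emb A) (witness 0).
- by move=> F F' /witness_inj[].
- by move=> F [].
- by move=> _ [B /sG sB <-]; exact/sentence_rename.
- by move=> _ [B _ <-].
- exact/sentence_rename.
- exact: emb_range.
- by move=> /derivable_conservative.
move=> [GT thT satT TA].
pose w : world (@canonical_model P ar C iC) := Stage thT.
have pw : prime_stage w.
  split => //=; first by move=> c; left; exists c.
  (* Only tag 0 has been used for witnesses, so 1 is a bound. *)
  by exists 1 => j F j1 [[]//|[F' [x [B [/witness_inj[j0]]]]]]; rewrite j0 in j1.
have holdsE B : sentence B -> satisfies w B <-> T (emb B).
  move=> sB; rewrite /satisfies truth //.
  - by rewrite collapse_diagram.
  - apply/(sentence_rename (@collapse_const P ar C iC)).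
    by rewrite -/(collapse _) collapse_diagram; exact/sentence_rename.
  - by rewrite collapse_diagram => c cB; left; exact: emb_range cB.
apply: TA; apply/holdsE => //; apply: GA => B GB.
by apply/holdsE; [exact: sG | apply: GT; exists B].
Qed.

End Completeness.

Theorem theorem22 (L : language) (G : set (form L)) (A : form L)
    (hG : forall B : form L, G B -> sentence B) (hA : sentence A) :
  entails G A -> derivable G A.
(* Taking the language apart into its components presents it as a [lang_on]. *)
Proof. by case: L G A hG hA => C P ar iC G A; exact: (@completeness P ar C iC). Qed.
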